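(* Let $N$ be a Cox process directed by a non-decreasing càdlàg process $\eta$ with $\eta(0)=0$, which is stochastically continuous. Denote the arrival times of $N$ by $0\le T_1\le T_2\le\cdots$. Let $0=t_0<t_1<t_2<\cdots<t_k\le t$, $k\in\mathbb N$, $t>0$. Denote finer points in the intervals $(t_{j-1},t_j]$, $j=1,\dots,k$, by $t_{j-1}<t_{j1}\le\cdots\le t_{j\ell_j}\le t_j$, $\ell_j\in\mathbb Z_+$, and write $s_k=\sum_{j=1}^k\ell_j$ (with $s_0=0$). Then (i) for any $k\in\mathbb N$, $\ell_j\in\mathbb Z_+$, $j\le k$, $$\mathbb P\Big(\bigcap_{j=1}^k\{N(t_{j-1},t_j]=\ell_j\}\Big)=\prod_{j=1}^k\mathbb P\big(N(t_{j-1},t_j]=\ell_j\big)$$ holds if and only if $\eta$ is an additive process, and in this case $$\mathbb P\Big(\bigcap_{j=1}^k\{T_{s_{j-1}+1}\le t_{j1},\dots,T_{s_j}\le t_{j\ell_j},\ N(t_{j-1},t_j]=\ell_j\}\Big)=\prod_{j=1}^k\mathbb P\big(T_{s_{j-1}+1}\le t_{j1},\dots,T_{s_j}\le t_{j\ell_j},\ N(t_{j-1},t_j]=\ell_j\big).$$ (ii) for any $k\in\mathbb N$, $\ell_j\in\mathbb Z_+$, $j\le k$, $$\mathbb P\Big(\bigcap_{j=1}^k\{N(t_{j-1},t_j]=\ell_j\}\Big)=\prod_{j=1}^k\mathbb P\big(N(0,t_j-t_{j-1}]=\ell_j\big)$$ holds if and only if $\eta$ is a subordinator, and in this case $$\mathbb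 P\Big(\bigcap_{j=1}^k\{T_{s_{j-1}+1}\le t_{j1},\dots,T_{s_j}\le t_{j\ell_j},\ N(t_{j-1},t_j]=\ell_j\}\Big)=\prod_{j=1}^k\mathbb P\big(T_1\le t_{j1}-t_{j-1},\dots,T_{\ell_j}\le t_{j\ell_j}-t_{j-1},\ N(0,t_j-t_{j-1}]=\ell_j\big).$$
   Context: $\mathbb Z_+=\{0,1,2,\dots\}$. For a process $X$ and $s<t$, $X(s,t]:=X(t)-X(s)$. A non-decreasing càdlàg process $\eta$ with $\eta(0)=0$ a.s. is identified with the random (Lebesgue–Stieltjes) measure it defines. A Cox process $N=(N(t))_{t\ge0}$ directed by $\eta$ is a point process which, conditionally on $\eta$, is a Poisson process with mean measure $\eta$: given $\eta$, increments over disjoint intervals are independent and $N(s,t]$ is Poisson with mean $\eta(s,t]$. $T_i$ denotes the $i$-th arrival time of $N$ (multiple points are allowed). If $\ell_j=0$ there is no condition on arrival times in the $j$-th interval. An additive process $V=(V(u))_{u\ge0}$ is a stochastically continuous process with independent increments and càdlàg paths, starting at $V(0)=0$ a.s. By the paper's standing convention additive processes are restricted to those having only a pure jump part, i.e. $\mathbb E[e^{ixV(u)}]=\exp\{\int_{(0,u]\times\mathbb R}(e^{ixv}-1)\,\rho(d(w,v))\}$ for a measure $\rho$ on $(0,\infty)\times\mathbb R$ (first coordinate time, second jump size) with $\rho((0,\cdot]\times\{0\})=0$, $\rho(\{u\}\times\mathbb R)=0$ and $\int_{(0,u]\times\mathbb R}(|v|\wedge1)\,\rho(d(w,v))<\infty$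 for $u\ge0$. A subordinator is a non-decreasing Lévy process $V$ (stationary independent increments, stochastically continuous, càdlàg, $V(0)=0$ a.s.), with Laplace transform $\mathbb E[e^{-xV(1)}]=\exp\{-\gamma x+\int_{(0,\infty)}(e^{-xv}-1)\,\nu(dv)\}$, $x\ge0$, where $\gamma\ge0$ and $\int_{(0,\infty)}(1\wedge s)\,\nu(ds)<\infty$.
   Formalization: In (i), T_{s_{j-1}+i} in the right-hand factors is read as the i-th arrival after t_{j-1}, i.e. T_{N(t_{j-1})+i} (the literal formula fails for Poisson); ''additive'' drops the pure-jump convention, since η(t)=t satisfies the product rule but is not pure jump. *)

(* Defs.v *)
From HB Require Import structures.
From mathcomp Require Import all_boot all_order all_algebra.
From mathcomp Require Import all_classical all_reals all_analysis.
From mathcomp Require Import measurable_realfun.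

Set Implicit Arguments.
Unset Strict Implicit.
Unset Printing Implicit Defensive.

Import Order.TTheory GRing.Theory Num.Theory.
Import numFieldNormedType.Exports.

Local Open Scope classical_set_scope.
Local Open Scope ring_scope.

(* Processes are indexed by R, but only times t >= 0 are ever constrained. *)

Section paths.
Context {R : realType}.

Definition cadlag (x : R -> R) : Prop :=
  (forall t, 0 <= t -> x s @[s --> t^'+] --> x t) /\
  (forall t, 0 < t -> cvg (x s @[s --> t^'-])).

Definition nondecreasing_path (x : R -> R) : Prop :=
  forall s t, 0 <= s -> s <= t -> x s <= x t.

End paths.

Section processes.
Context {d : measure_display} {T : measurableType d} {R : realType}
  {P : probability T R}.
Implicit Types (V eta : R -> {RV P >-> R}) (N : R -> {RV P >-> nat}).

Definition incr V (s t : R) (w : T) : R := V t w - V s w.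

Definition stochastically_continuous V : Prop :=
  forall t, 0 <= t -> forall eps : R, 0 < eps ->
    P [set w | eps < `|V s w - V t w|]
      @[s --> within [set s | 0 <= s] (nbhs t)] --> 0%E.

(* For a finite family, B i = setT shows that the product rule over the whole
   family contains the product rule over each of its subfamilies. *)
Definition independent_family (n : nat) (X : 'I_n -> T -> R) : Prop :=
  forall B : 'I_n -> set R, (forall i, measurable (B i)) ->
    P [set w | forall i, B i (X i w)] = (\prod_(i < n) P (X i @^-1` B i))%E.

Definition independent_increments V : Prop :=
  forall (n : nat) (t : nat -> R), 0 <= t 0%N ->
    (forall i, (i < n)%N -> t i < t i.+1) ->
    independent_family (fun i : 'I_n => incr V (t i) (t i.+1)).

Definition stationary_increments V : Prop :=
  forall s h : R, 0 <= s -> 0 <= h -> forall B : set R, measurable B ->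
    P (incr V s (s + h) @^-1` B) = P (incr V 0 h @^-1` B).

Definition additive_process V : Prop :=
  [/\ {ae P, forall w, V 0 w = 0}, forall w, cadlag (V ^~ w),
      stochastically_continuous V & independent_increments V].

Definition levy_process V : Prop :=
  additive_process V /\ stationary_increments V.

Definition subordinator V : Prop :=
  levy_process V /\ forall w, nondecreasing_path (V ^~ w).

Definition process_sigma V : set_system T :=
  <<s \bigcup_(t in [set t | 0 <= t]) preimage_set_system setT (V t) measurable >>.

(* f is a version of the conditional probability P(A | G). *)
Definition is_cond_prob (G : set_system T) (A : set T) (f : T -> \bar R) : Prop :=
  (forall B : set (\bar R), measurable B -> G (f @^-1` B)) /\
  (forall C, G C -> P (C `&` A) = (\int[P]_(w in C) f w)%E).

(* N(s, t]; the truncated subtraction is exact, as paths are nondecreasing. *)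
Definition incrN N (s t : R) (w : T) : nat := (N t w - N s w)%N.

(* Counting function t |-> N((0, t]) of a point process; jumps of size > 1 are
   multiple points. *)
Definition point_process N : Prop :=
  [/\ {ae P, forall w, N 0 w = 0%N}, forall w, cadlag (fun t => (N t w)%:R : R)
    & forall w s t, 0 <= s -> s <= t -> (N s w <= N t w)%N].

(* The second argument of poisson_prob is unused.  poisson_prob is used rather
   than poisson_pmf because the mean may be 0, where poisson_prob is the Dirac
   mass at 0 whereas poisson_pmf is identically 1. *)
Definition cox_process eta N : Prop :=
  point_process N /\
  forall (n : nat) (a b : 'I_n -> R) (l : 'I_n -> nat),
    (forall i, 0 <= a i <= b i) ->
    trivIset setT (fun i : 'I_n => `]a i, b i]%classic) ->
    is_cond_prob (process_sigma eta)
      [set w | forall i, incrN N (a i) (b i) w = l i]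
      (fun w => \prod_(i < n)
         poisson_prob (incr eta (a i) (b i) w) 0%N [set l i])%E.

(* T_i, for i >= 1; it is +oo when N has fewer than i points. *)
Definition arrival N (i : nat) (w : T) : \bar R :=
  ereal_inf [set t%:E | t in [set t : R | 0 <= t /\ (i <= N t w)%N]].

End processes.

Section partitions.
Context {R : realType}.

(* 0 = t_0 < t_1 < ... < t_k <= t *)
Definition partition_upto (t : R) (k : nat) (tau : nat -> R) : Prop :=
  [/\ 0 < t, (0 < k)%N, tau 0%N = 0, forall j, (j < k)%N -> tau j < tau j.+1
    & tau k <= t].

(* Intervals and points are numbered from 0: u j i, for j < k and i < l j, is
   the point t_{j+1,i+1} of the interval ]tau j, tau j.+1]. *)
Definition finer_points (k : nat) (tau : nat -> R) (l : nat -> nat)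
    (u : nat -> nat -> R) : Prop :=
  forall j, (j < k)%N ->
    (forall i, (i < l j)%N -> tau j < u j i <= tau j.+1) /\
    (forall i, (i.+1 < l j)%N -> u j i <= u j i.+1).

End partitions.

(* Main.v *)
(* By the Cox property, the joint probabilities of counts over disjoint
   intervals are the means of products of Poisson weights exp(-x) x^l / l!
   evaluated at the increments of eta.  A finite measure mu on [0, oo) is
   determined by its integrals of these weights: expanding exp(-e x) in powers of
   x turns the rate 1 of the exponential into any rate c >= 1, and, as c grows,
   the Poisson probabilities of {l <= c t} at mean c x tend to the indicator of
   {x <= t}.  Replacing Poisson weights by indicators of Borel sets, one
   coordinate at a time, hence turns the product rule for the counts of N into the
   product rule for the increments of eta, and back.  On the event fixing the
   counts, T_(s_(j-1)+i) <= t_(j,i) says that at least i points of N lie in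
   ]t_(j-1), t_(j,i)], so the statements on arrival times are product rules for
   the counts over a finer partition. *)

(* Poisson weights of rate 1 are not closed under products, so the usual monotone-class argument
   does not apply to them directly; this is why the rate has to be raised. Expanding exp(-e x) under
   the integral needs a dominating function: the absolute partial sums are bounded by exp(e x), and
   a factor exp(-x / 2) has to survive in order to control x^l. Hence the rate grows in steps of at
   most 1/2, repeated as often as necessary. A product rule is linear in each factor, so freezing
   the other factors in a bounded density reduces it to a statement about one variable and two
   densities. The same reduction serves for counts, with points of a countable type in place of
   Poisson weights. Two mismatches remain to be bridged: partitions start at 0 and increase
   strictly, while increments may start later and finer points may coincide. *)
Require Import Defs.
From HB Require Import structures.
From mathcomp Require Import all_boot all_order all_algebra.
From mathcomp Require Import all_classical all_reals all_analysis.
From mathcomp Require Import measurable_realfun.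
From mathcomp Require Import zify ring lra.
Import Order.TTheory GRing.Theory Num.Theory.
Import numFieldNormedType.Exports.
Import HBNNSimple.
Local Open Scope classical_set_scope.
Local Open Scope ring_scope.

(** * Bounded random variables *)

Section bounded_measurable.
Context {d : measure_display} {T : measurableType d} {R : realType}
  {P : probability T R}.
Implicit Types f g : T -> R.

Definition bounded_mfun f : Prop :=
  measurable_fun setT f /\ exists M : R, forall w, `|f w| <= M.

Lemma bounded_mfun_integrable f :
  bounded_mfun f -> P.-integrable setT (EFin \o f).
Proof.
move=> [mf [M fM]]; apply: measurable_bounded_integrable => //.
  exact: le_lt_trans (probability_le1 P measurableT) (ltry _).
exists M; split; first exact: num_real.
by move=> x Mx w _ /=; exact: le_trans (fM w) (ltW Mx).
Qed.

Lemma bounded_mfun_cst (c : R) : bounded_mfun (fun=> c).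
Proof. by split=> //; exists `|c|. Qed.

Lemma bounded_mfunD f g :
  bounded_mfun f -> bounded_mfun g -> bounded_mfun (fun w => f w + g w).
Proof.
move=> [mf [M fM]] [mg [K gK]]; split; first exact: measurable_funD.
by exists (M + K) => w; apply: le_trans (ler_normD _ _) _; exact: lerD.
Qed.

Lemma bounded_mfunM f g :
  bounded_mfun f -> bounded_mfun g -> bounded_mfun (fun w => f w * g w).
Proof.
move=> [mf [M fM]] [mg [K gK]]; split; first exact: measurable_funM.
by exists (M * K) => w; rewrite normrM; exact: ler_pM.
Qed.

Lemma bounded_mfunZ (c : R) f :
  bounded_mfun f -> bounded_mfun (fun w => c * f w).
Proof. by apply: bounded_mfunM; exact: bounded_mfun_cst. Qed.

Lemma bounded_mfun_prod (I : Type) (r : seq I) (D : pred I) (F : I -> T -> R) :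
  (forall i, D i -> bounded_mfun (F i)) ->
  bounded_mfun (fun w => \prod_(i <- r | D i) F i w).
Proof.
move=> bF; elim: r => [|i r IH].
  by under eq_fun do rewrite big_nil; exact: bounded_mfun_cst.
under eq_fun do rewrite big_cons.
by case Di: (D i) => //; apply: bounded_mfunM => //; exact: bF.
Qed.

Lemma bounded_mfun_indic (A : set T) :
  measurable A -> bounded_mfun (\1_A : T -> R).
Proof.
move=> mA; split; first exact: measurable_indic.
by exists 1 => w; rewrite indicE; case: (_ \in _); rewrite ?normr1 ?normr0.
Qed.

Lemma mean_cst (c : R) : \int[P]_w c = c.
Proof.
transitivity (c * fine (P [set: T])); first exact: Rintegral_cst.
by rewrite probability_setT mulr1.
Qed.

Lemma mean_indic (A : set T) : measurable A -> \int[P]_w \1_A w = fine (P A).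
Proof. by move=> mA; rewrite /Rintegral integral_indic// setIT. Qed.

Lemma meanD f g : bounded_mfun f -> bounded_mfun g ->
  \int[P]_w (f w + g w) = \int[P]_w f w + \int[P]_w g w.
Proof. by move=> bf bg; rewrite RintegralD//; exact: bounded_mfun_integrable. Qed.

Lemma meanZ (c : R) f : bounded_mfun f ->
  \int[P]_w (c * f w) = c * \int[P]_w f w.
Proof. by move=> bf; rewrite RintegralZl//; exact: bounded_mfun_integrable. Qed.

Lemma bounded_mfun_lim (F : nat -> T -> R) f (M : R) :
  (forall n, measurable_fun setT (F n)) ->
  (forall n w, `|F n w| <= M) ->
  (forall w, F n w @[n --> \oo] --> f w) -> bounded_mfun f.
Proof.
move=> mF FM Ff; split.
  by apply: (@measurable_fun_cvg _ _ _ setT F) => // w _; exact: Ff.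
exists M => w; have /cvg_norm nF := Ff w.
by apply: (cvgr_to_le nF); apply: nearW => n; exact: FM.
Qed.

Lemma mean_bounded_cvg (F : nat -> T -> R) f (M : R) :
  (forall n, measurable_fun setT (F n)) ->
  (forall n w, `|F n w| <= M) ->
  (forall w, F n w @[n --> \oo] --> f w) ->
  \int[P]_w F n w @[n --> \oo] --> \int[P]_w f w.
Proof.
move=> mF FM Ff.
have bf : bounded_mfun f := bounded_mfun_lim _ _ _ mF FM Ff.
have [mf _] := bf.
have [] := @dominated_convergence _ T R P setT measurableT
  (fun n w => (F n w)%:E) (fun w => (f w)%:E) (fun=> M%:E).
- by move=> n; exact/measurable_EFinP.
- exact/measurable_EFinP.
- by apply: aeW => w _; apply: cvg_EFin; [exact: nearW|exact: Ff].
- by apply: (bounded_mfun_integrable (fun=> M)); exact: bounded_mfun_cst.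
- by apply: aeW => w n _; rewrite lee_fin.
move=> _ _ cvgI; rewrite /Rintegral.
have fin : (\int[P]_w (f w)%:E \is a fin_num)%E.
  by apply: integrable_fin_num => //; exact: bounded_mfun_integrable.
by apply: fine_cvg; rewrite fineK.
Qed.

End bounded_measurable.

(** * Weighted laws and test functions *)

Section agreement.
Context {d : measure_display} {T : measurableType d} {R : realType}
  {P : probability T R} {V : Type}.
Variables (X Y : T -> V) (G H : T -> R).
Hypotheses (bG : bounded_mfun G) (bH : bounded_mfun H).
Implicit Types f g : V -> R.

(* The laws of X and Y, with densities G and H, are compared as finite measures
   on V through the test function f. *)
Definition agree f : Prop :=
  [/\ bounded_mfun (f \o X), bounded_mfun (f \o Y) &
      \int[P]_w (f (X w) * G w) = \int[P]_w (f (Y w) * H w)].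

Lemma eq_agree f g : (forall w, f (X w) = g (X w)) ->
  (forall w, f (Y w) = g (Y w)) -> agree f -> agree g.
Proof.
move=> fgX fgY [bX bY e]; split.
- by rewrite (_ : g \o X = f \o X)//; apply/funext => w; rewrite /= fgX.
- by rewrite (_ : g \o Y = f \o Y)//; apply/funext => w; rewrite /= fgY.
- by under eq_Rintegral do rewrite -fgX; under [RHS]eq_Rintegral do rewrite -fgY.
Qed.

Lemma agreeD f g : agree f -> agree g -> agree (fun x => f x + g x).
Proof.
move=> [fX fY fe] [gX gY ge]; split; [exact: bounded_mfunD..|].
under eq_Rintegral do rewrite mulrDl; under [RHS]eq_Rintegral do rewrite mulrDl.
by rewrite !meanD ?fe ?ge//; exact: bounded_mfunM.
Qed.

Lemma agreeZ (c : R) f : agree f -> agree (fun x => c * f x).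
Proof.
move=> [fX fY fe]; split; [exact: bounded_mfunZ..|].
under eq_Rintegral do rewrite -mulrA; under [RHS]eq_Rintegral do rewrite -mulrA.
by rewrite !meanZ ?fe//; exact: bounded_mfunM.
Qed.

Lemma agree0 : agree (fun=> 0).
Proof.
split; [exact: bounded_mfun_cst..|].
by under eq_Rintegral do rewrite mul0r; under [RHS]eq_Rintegral do rewrite mul0r.
Qed.

Lemma agree_sum (I : Type) (r : seq I) (F : I -> V -> R) :
  (forall i, agree (F i)) -> agree (fun x => \sum_(i <- r) F i x).
Proof.
move=> aF; elim: r => [|i r IH].
  by under eq_fun do rewrite big_nil; exact: agree0.
by under eq_fun do rewrite big_cons; exact: agreeD.
Qed.

(** Dominated convergence in both integrals. Bound and limit are asked only along [X] and [Y],
    because Poisson weights behave well only at nonnegative arguments. *)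
Lemma agree_lim (F : nat -> V -> R) f (M : R) : (forall n, agree (F n)) ->
  (forall n w, `|F n (X w)| <= M) -> (forall n w, `|F n (Y w)| <= M) ->
  (forall w, F n (X w) @[n --> \oo] --> f (X w)) ->
  (forall w, F n (Y w) @[n --> \oo] --> f (Y w)) -> agree f.
Proof.
move=> aF MX MY cX cY.
have mFX n : measurable_fun setT (F n \o X) by have [[]] := aF n.
have mFY n : measurable_fun setT (F n \o Y) by have [_ []] := aF n.
split.
- exact: (bounded_mfun_lim (fun n => F n \o X) _ M).
- exact: (bounded_mfun_lim (fun n => F n \o Y) _ M).
have M0 (w : T) : 0 <= M by exact: le_trans (MX 0%N w).
have lim Z K : bounded_mfun K -> (forall n, measurable_fun setT (F n \o Z)) ->
    (forall n w, `|F n (Z w)| <= M) ->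
    (forall w, F n (Z w) @[n --> \oo] --> f (Z w)) ->
    \int[P]_w (F n (Z w) * K w) @[n --> \oo] --> \int[P]_w (f (Z w) * K w).
  move=> [mK [C KC]] mF FM Ff; apply: (mean_bounded_cvg _ _ (M * C)) => [n|n w|w].
  - by apply: measurable_funM => //; exact: mF n.
  - by rewrite normrM ler_pM.
  - by apply: cvgM => //; exact: cvg_cst.
have /cvg_lim <- // := lim X G bG mFX MX cX.
have /cvg_lim <- // := lim Y H bH mFY MY cY.
by congr (limn _); apply/funext => n; have [_ _ ->] := aF n.
Qed.

End agreement.

(** * Poisson weights *)

Section poisson_weights.
Context {R : realType}.
Implicit Types x y : R.

Definition pois (l : nat) x : R := expR (- x) * exp_coeff x l.

Lemma pois_ge0 l x : 0 <= x -> 0 <= pois l x.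
Proof. by move=> x0; rewrite mulr_ge0 ?expR_ge0// exp_coeff_ge0. Qed.

Lemma poisS l x : l.+1%:R * pois l.+1 x = x * pois l x.
Proof.
rewrite /pois /exp_coeff /= exprS factS natrM.
rewrite invfM; have : l.+1%:R != 0 :> R by rewrite pnatr_eq0.
move: (l`!%:R^-1) => c l0; by field.
Qed.

Lemma cvg_pois0 x : pois l x @[l --> \oo] --> 0.
Proof.
rewrite -(mulr0 (expR (- x))); apply: cvgM; first exact: cvg_cst.
exact: cvg_exp_coeff.
Qed.

Lemma cvg_series_exp_coeff x : series (exp_coeff x) n @[n --> \oo] --> expR x.
Proof. exact: is_cvg_series_exp_coeff. Qed.

Lemma series_exp_coeff_ler x n : 0 <= x -> series (exp_coeff x) n <= expR x.
Proof.
move=> x0; apply: nondecreasing_cvgn_le; last exact: is_cvg_series_exp_coeff.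
by apply: nondecreasing_series => i _ _; exact: exp_coeff_ge0.
Qed.

Lemma sum_poisE n x :
  \sum_(l < n) pois l x = expR (- x) * series (exp_coeff x) n.
Proof. by rewrite /series /= big_mkord mulr_sumr. Qed.

Lemma cvg_sum_pois x : \sum_(l < n) pois l x @[n --> \oo] --> (1 : R).
Proof.
under eq_fun do rewrite sum_poisE.
rewrite -(expRxMexpNx_1 x) mulrC; apply: cvgM; first exact: cvg_cst.
exact: cvg_series_exp_coeff.
Qed.

Lemma sum_pois_ge0 n x : 0 <= x -> 0 <= \sum_(l < n) pois l x.
Proof. by move=> x0; apply: sumr_ge0 => l _; exact: pois_ge0. Qed.

Lemma sum_pois_le1 n x : 0 <= x -> \sum_(l < n) pois l x <= 1.
Proof.
move=> x0; rewrite sum_poisE expRN mulrC ler_pdivrMr ?expR_gt0// mul1r.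
exact: series_exp_coeff_ler.
Qed.

Lemma pois_le1 l x : 0 <= x -> pois l x <= 1.
Proof.
move=> x0; apply: le_trans (sum_pois_le1 l.+1 x x0).
by rewrite big_ord_recr /= lerDr sum_pois_ge0.
Qed.

Let var n x := \sum_(l < n) (l%:R - x) ^+ 2 * pois l x.

(** The truncated second moment keeps its boundary terms exactly. They vanish as [n] grows, which
    leaves the variance [x]; the induction rests on the recursion [poisS], used twice. *)
Lemma poisson_varE n x :
  var n.+2 x = x * (\sum_(l < n.+1) pois l x)
               + x ^+ 2 * (pois n.+1 x - pois n x).
Proof.
elim: n => [|n IH].
  rewrite /var !big_ord_recr !big_ord0 /=.
  have -> : pois 1 x = x * pois 0 x by rewrite -poisS mul1r.
  by ring.
rewrite /var big_ord_recr /= -/(var n.+2 x) IH [in RHS]big_ord_recr /=.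
have e2 := poisS n.+1 x; have e1 := poisS n x.
have {}e1 : x ^+ 2 * pois n x = n.+1%:R * n.+2%:R * pois n.+2 x.
  by rewrite expr2 -mulrA -e1 mulrCA -e2; ring.
have e3 : x ^+ 2 * pois n.+1 x = x * n.+2%:R * pois n.+2 x.
  by rewrite expr2 -mulrA -e2; ring.
rewrite !mulrDr mulrN e1 mulrN e3 -e2 -!(natr1 n.+1) -!(natr1 n); ring.
Qed.

Lemma poisson_var_le n x : 0 <= x -> var n x <= x.
Proof.
move=> x0; have cv : var n x @[n --> \oo] --> x.
  have cv2 : var n.+2 x @[n --> \oo] --> x * 1 + x ^+ 2 * (0 - 0).
    under eq_fun do rewrite poisson_varE.
    apply: cvgD; apply: cvgM; [exact: cvg_cst| |exact: cvg_cst|].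
      by have := cvg_sum_pois x; rewrite -cvg_shiftS.
    apply: cvgB; last exact: cvg_pois0.
    by have := cvg_pois0 x; rewrite -cvg_shiftS.
  rewrite -cvg_shiftS -cvg_shiftS /=.
  by rewrite subrr mulr0 addr0 mulr1 in cv2.
have nd : nondecreasing_seq (fun n => var n x).
  apply/nondecreasing_seqP => m; rewrite /var big_ord_recr /= lerDl.
  by rewrite mulr_ge0 ?sqr_ge0 ?pois_ge0.
have := nondecreasing_cvgn_le nd (cvgP _ cv) n.
by rewrite (cvg_lim _ cv).
Qed.

(** Chebyshev: every [l < K] differs from the mean [x] by at least [x - K]. The product form avoids
    dividing by a gap that may be zero. *)
Lemma poisson_lower_tail (K : nat) x : 0 <= x -> K%:R <= x ->
  (\sum_(l < K) pois l x) * (x - K%:R) ^+ 2 <= x.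
Proof.
move=> x0 Kx; apply: le_trans (poisson_var_le K x x0).
rewrite mulr_suml; apply: ler_sum => l _; rewrite mulrC.
apply: ler_wpM2r; first exact: pois_ge0.
have lK : l%:R <= K%:R :> R by rewrite ler_nat ltnW.
by nra.
Qed.

(** The upper tail is the complement of a partial sum, so Chebyshev is applied to the terms from [K]
    up to [n], and [n] is sent to infinity. *)
Lemma poisson_upper_tail (K : nat) x : 0 <= x -> x <= K%:R ->
  (1 - \sum_(l < K) pois l x) * (K%:R - x) ^+ 2 <= x.
Proof.
move=> x0 xK.
have cv : (\sum_(l < n) pois l x - \sum_(l < K) pois l x) * (K%:R - x) ^+ 2
    @[n --> \oo] --> (1 - \sum_(l < K) pois l x) * (K%:R - x) ^+ 2.
  apply: cvgM; last exact: cvg_cst.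
  by apply: cvgB; [exact: cvg_sum_pois|exact: cvg_cst].
apply: (cvgr_to_le cv); exists K => // n /= Kn.
apply: le_trans (poisson_var_le n x x0).
rewrite -!(big_mkord predT (pois ^~ x)) (big_cat_nat (n := K))//= addrAC subrr add0r.
rewrite /var -(big_mkord predT (fun l => (l%:R - x) ^+ 2 * pois l x)).
rewrite [leRHS](big_cat_nat (n := K))//= -[leLHS]add0r lerD//.
  by apply: sumr_ge0 => l _; rewrite mulr_ge0 ?sqr_ge0 ?pois_ge0.
rewrite mulr_suml big_seq [leRHS]big_seq; apply: ler_sum => l.
rewrite mem_index_iota => /andP[Kl _]; rewrite mulrC.
apply: ler_wpM2r; first exact: pois_ge0.
have lK : K%:R <= l%:R :> R by rewrite ler_nat.
by nra.
Qed.

Lemma measurable_pois l : measurable_fun setT (pois l).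
Proof.
rewrite /pois /exp_coeff /=; apply: measurable_funM.
  by apply: measurableT_comp => //; exact: measurable_expR.
by apply: measurable_funM => //; exact: exprn_measurable.
Qed.

Lemma bounded_mfun_pois d (T : measurableType d) (X : T -> R) l :
  measurable_fun setT X -> (forall w, 0 <= X w) ->
  bounded_mfun (fun w => pois l (X w)).
Proof.
move=> mX X0; split; first exact: measurableT_comp (measurable_pois l) mX.
by exists 1 => w; rewrite ger0_norm ?pois_ge0 ?pois_le1.
Qed.

End poisson_weights.

(** * Smooth approximations of indicators of half-lines *)

Section poisson_cutoff.
Context {R : realType}.
Implicit Types x t : R.

(* The rate n^4 with the threshold n^4 t + n^3 lets the Chebyshev bounds also
   settle the boundary point x = t, so that the limit is exactly the indicator
   of [x <= t]. *)
Definition poisson_cutoff (t : R) (n : nat) (x : R) : R :=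
  \sum_(l < (Num.truncn (n.+1%:R ^+ 4 * t + n.+1%:R ^+ 3)).+1)
     pois l (n.+1%:R ^+ 4 * x).

Lemma poisson_cutoff_itv t n x : 0 <= x -> 0 <= poisson_cutoff t n x <= 1.
Proof.
move=> x0; have nx0 : 0 <= n.+1%:R ^+ 4 * x by rewrite mulr_ge0 ?exprn_ge0.
by rewrite sum_pois_ge0//= sum_pois_le1.
Qed.

(** Put a = n + 1. The mean is a^4 x and the threshold exceeds it by at least a^3, so Chebyshev
    bounds the missing mass by a^4 x / a^6. The resulting x / a^2 is weakened to x / a, a multiple
    of the harmonic sequence. *)
Lemma poisson_cutoff_le t n x : 0 <= x -> x <= t ->
  1 - poisson_cutoff t n x <= x * n.+1%:R^-1.
Proof.
move=> x0 xt; rewrite /poisson_cutoff; set a : R := n.+1%:R.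
have a1 : 1 <= a by rewrite ler1n.
have a0 : 0 < a by exact: lt_le_trans a1.
set K := (Num.truncn _).+1.
have AK : a ^+ 4 * t + a ^+ 3 < K%:R by exact: truncnS_gt.
have a4x : 0 <= a ^+ 4 * x by rewrite mulr_ge0// exprn_ge0// ltW.
have axt : a ^+ 4 * x <= a ^+ 4 * t by rewrite ler_pM2l ?exprn_gt0.
have a30 : 0 < a ^+ 3 by rewrite exprn_gt0.
have xK : a ^+ 4 * x <= K%:R by lra.
have := poisson_upper_tail K _ a4x xK.
have := sum_pois_le1 K _ a4x; set S := \sum_(l < K) _ => S1 tail.
have sq : (a ^+ 3) ^+ 2 <= (K%:R - a ^+ 4 * x) ^+ 2.
  by rewrite ler_sqr ?nnegrE; lra.
have : (1 - S) * (a ^+ 3) ^+ 2 <= a ^+ 4 * x.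
  by apply: le_trans tail; apply: ler_wpM2l => //; lra.
rewrite -exprM (_ : (3 * 2 = 4 + 2)%N)// exprD mulrCA ler_pM2l ?exprn_gt0//.
rewrite ler_pdivlMr// => h; apply: le_trans h.
by apply: ler_wpM2l; [lra|rewrite ler_eXnr].
Qed.

(** For large [n] the threshold lies well below the mean and Chebyshev gives x / a^2 again, with a =
    n + 1; the term 4 / (x - t) takes care of the remaining small [n]. *)
Lemma poisson_cutoff_gt t n x : 0 <= t -> t < x ->
  poisson_cutoff t n x <= (x + 4 / (x - t)) * n.+1%:R^-1.
Proof.
move=> t0 tx; have x0 : 0 <= x by lra.
have [_ S1] := andP (poisson_cutoff_itv t n x x0).
move: S1; rewrite /poisson_cutoff; set a : R := n.+1%:R.
have a1 : 1 <= a by rewrite ler1n.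
have a0 : 0 < a by exact: lt_le_trans a1.
set K := (Num.truncn _).+1; set S := \sum_(l < K) _ => S1.
have xt0 : 0 < x - t by lra.
have d0 : 0 < 4 / (x - t) by rewrite divr_gt0.
rewrite ler_pdivlMr//.
(* Below 4 the trivial bound 1 on the mass suffices. Otherwise a^4 (x - t) is at least 4 a^3, which
   absorbs the a^3 of the threshold and its rounding by 1 and still leaves 2 a^3. *)
have [axt|axt] := ltP (a * (x - t)) 4.
  have : a <= 4 / (x - t) by rewrite ler_pdivlMr// ltW.
  have : S * a <= a by rewrite ler_piMl// ltW.
  lra.
have KA : K%:R <= a ^+ 4 * t + a ^+ 3 + 1.
  rewrite /K -natr1 lerD2r.
  have A0 : 0 <= a ^+ 4 * t + a ^+ 3.
    by rewrite addr_ge0 ?mulr_ge0 ?exprn_ge0// ltW.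
  by have /andP[] := truncn_itv A0.
have a30 : 0 < a ^+ 3 by rewrite exprn_gt0.
have a31 : 1 <= a ^+ 3 by rewrite exprn_ege1.
have gap : 2 * a ^+ 3 <= a ^+ 4 * x - K%:R.
  have : a ^+ 3 * 4 <= a ^+ 3 * (a * (x - t)) by rewrite ler_pM2l.
  rewrite mulrA -exprSr mulrBr; lra.
have a4x : 0 <= a ^+ 4 * x by rewrite mulr_ge0// exprn_ge0// ltW.
have Kx : K%:R <= a ^+ 4 * x by lra.
have tail := poisson_lower_tail K _ a4x Kx; rewrite -/S in tail.
have S0 : 0 <= S by exact: sum_pois_ge0.
have sq : (a ^+ 3) ^+ 2 <= (a ^+ 4 * x - K%:R) ^+ 2.
  by rewrite ler_sqr ?nnegrE; lra.
have : S * (a ^+ 3) ^+ 2 <= a ^+ 4 * x.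
  by apply: le_trans tail; apply: ler_wpM2l => //; lra.
rewrite -exprM (_ : (3 * 2 = 4 + 2)%N)// exprD mulrCA ler_pM2l ?exprn_gt0//.
move=> h; have : S * a <= S * a ^+ 2 by apply: ler_wpM2l => //; rewrite ler_eXnr.
lra.
Qed.

Lemma cvg_poisson_cutoff t x : 0 <= t -> 0 <= x ->
  poisson_cutoff t n x @[n --> \oo] --> ((x <= t)%R%:R : R).
Proof.
move=> t0 x0; have h0 (C : R) : C * n.+1%:R^-1 @[n --> \oo] --> (0 : R).
  rewrite -(mulr0 C); apply: cvgM; first exact: cvg_cst.
  exact: cvg_harmonic.
have [xt|tx] := leP x t.
  apply: (@squeeze_cvgr _ _ _ _ (fun n => 1 - x * n.+1%:R^-1) (fun=> 1)).
  - apply: nearW => n; have /andP[_ ->] := poisson_cutoff_itv t n x x0.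
    by rewrite andbT lerBlDr -lerBlDl; exact: poisson_cutoff_le.
  - suff : 1 - x * n.+1%:R^-1 @[n --> \oo] --> (1 - 0 : R) by rewrite subr0.
    by apply: cvgB; [exact: cvg_cst|exact: h0].
  - exact: cvg_cst.
apply: (@squeeze_cvgr _ _ _ _ (fun=> 0)
  (fun n => (x + 4 / (x - t)) * n.+1%:R^-1)).
- apply: nearW => n; have /andP[-> _] := poisson_cutoff_itv t n x x0.
  exact: poisson_cutoff_gt.
- exact: cvg_cst.
- exact: h0.
Qed.

End poisson_cutoff.

(** * Determination of a measure by its Poisson mixture *)

Section determination.
Context {d : measure_display} {T : measurableType d} {R : realType}
  {P : probability T R}.
Variables (X Y : T -> R) (G H : T -> R).
Hypotheses (X0 : forall w, 0 <= X w) (Y0 : forall w, 0 <= Y w).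
Hypotheses (bG : bounded_mfun G) (bH : bounded_mfun H).

Local Notation agree := (@agree _ T R P R X Y G H).

Lemma agree_lim_ge0 (F : nat -> R -> R) (f : R -> R) (M : R) :
  (forall n, agree (F n)) ->
  (forall n x, 0 <= x -> `|F n x| <= M) ->
  (forall x, 0 <= x -> F n x @[n --> \oo] --> f x) -> agree f.
Proof.
move=> aF FM Ff; apply: (agree_lim _ _ _ _ bG bH _ _ M aF) => *.
- exact: FM.
- exact: FM.
- exact: Ff.
- exact: Ff.
Qed.

Let damped (c : R) (l : nat) (x : R) : R := x ^+ l * expR (- (c * x)).

(** The bound [pois_le1] at x / 2, cleared of denominators. *)
Lemma damped_le (l : nat) (x : R) : 0 <= x ->
  x ^+ l * expR (- (2^-1 * x)) <= l`!%:R * 2 ^+ l.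
Proof.
move=> x0; have h0 : 0 <= 2^-1 * x by rewrite mulr_ge0.
have := pois_le1 l _ h0; rewrite /pois /exp_coeff /= => h.
have l0 : 0 < l`!%:R * 2 ^+ l :> R by rewrite mulr_gt0 ?exprn_gt0// ltr0n fact_gt0.
rewrite -[leRHS]mul1r -ler_pdivrMr//; apply: le_trans h.
rewrite exprMn exprVn invfM le_eqVlt; apply/orP; left; apply/eqP; ring.
Qed.

(** Partial sums of the series of exp(-e x), multiplied by [damped c l], are combinations of the
    functions [damped c (l + m)]. In absolute value they are at most x^l exp(-(c - e) x), and c - e
    is at least 1/2, so [damped_le] dominates them. *)
Lemma agree_damped_shift (c e : R) : 1 <= c -> 0 <= e <= 2^-1 ->
  (forall l, agree (damped c l)) -> forall l, agree (damped (c + e) l).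
Proof.
move=> c1 /andP[e0 e2] ac l.
apply: (agree_lim_ge0
    (fun n x => damped c l x * series (exp_coeff (- (e * x))) n) _
    (l`!%:R * 2 ^+ l)) => [n|n x x0|x x0].
- apply: (@eq_agree _ _ _ _ _ _ _ _ _
    (fun x => \sum_(m < n) ((- e) ^+ m / m`!%:R) * damped c (l + m) x)).
  + move=> w; rewrite /series /= big_mkord mulr_sumr; apply: eq_bigr => m _.
    by rewrite /exp_coeff /damped /= -(mulNr e) exprMn exprD; ring.
  + move=> w; rewrite /series /= big_mkord mulr_sumr; apply: eq_bigr => m _.
    by rewrite /exp_coeff /damped /= -(mulNr e) exprMn exprD; ring.
  + by apply: (agree_sum _ _ _ _ bG bH) => m; exact: (agreeZ _ _ _ _ bG bH).
- rewrite normrM ger0_norm; last by rewrite mulr_ge0 ?exprn_ge0 ?expR_ge0.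
  apply: (@le_trans _ _ (damped c l x * expR (e * x))).
    apply: ler_wpM2l; first by rewrite mulr_ge0 ?exprn_ge0 ?expR_ge0.
    apply: le_trans (series_exp_coeff_ler _ n _); last by rewrite mulr_ge0.
    rewrite /series /= !big_mkord; apply: le_trans (ler_norm_sum _ _ _) _.
    apply: ler_sum => m _; rewrite /exp_coeff /= normrM normrX normrN.
    rewrite [`|e * x|]ger0_norm ?mulr_ge0//.
    by rewrite ger0_norm// invr_ge0.
  apply: le_trans (damped_le l x x0).
  rewrite /damped -mulrA -expRD; apply: ler_wpM2l; first exact: exprn_ge0.
  rewrite ler_expR; nra.
- rewrite /damped mulrDl opprD expRD mulrA.
  by apply: cvgM; [exact: cvg_cst|exact: cvg_series_exp_coeff].
Qed.

Lemma agree_damped : (forall l, agree (pois l)) ->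
  forall c, 1 <= c -> forall l, agree (damped c l).
Proof.
move=> ap.
suff h n : forall c, 1 <= c <= 1 + n%:R * 2^-1 -> forall l, agree (damped c l).
  (* Starting at the rate 1, more than 2 c steps of length 1/2 pass beyond [c]. *)
  move=> c c1; apply: (h (Num.truncn (2 * c)).+1); rewrite c1 /=.
  by have := truncnS_gt (2 * c); lra.
elim: n => [|n IH] c /andP[c1 cn] l.
  have -> : c = 1 by lra.
  apply: (@eq_agree _ _ _ _ _ _ _ _ _ (fun x => l`!%:R * pois l x)).
  + move=> w; rewrite /pois /damped /exp_coeff /= mul1r.
    by field; rewrite pnatr_eq0 -lt0n fact_gt0.
  + move=> w; rewrite /pois /damped /exp_coeff /= mul1r.
    by field; rewrite pnatr_eq0 -lt0n fact_gt0.
  + exact: (agreeZ _ _ _ _ bG bH).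
rewrite -natr1 in cn.
have [cn'|cn'] := leP c (1 + n%:R * 2^-1); first by apply: IH; rewrite c1.
have n0 : 0 <= n%:R :> R by [].
rewrite -(subrKC (1 + n%:R * 2^-1) c).
by apply: agree_damped_shift; [|lra|move=> m; apply: IH]; lra.
Qed.

Lemma agree_poisson_cutoff (t : R) n : (forall l, agree (pois l)) ->
  agree (poisson_cutoff t n).
Proof.
move=> ap; apply: (agree_sum _ _ _ _ bG bH) => i; move: (nat_of_ord i) => {i} l.
have : 1 <= n.+1%:R ^+ 4 :> R by rewrite exprn_ege1// ler1n.
move: (n.+1%:R ^+ 4) => c c1.
apply: (@eq_agree _ _ _ _ _ _ _ _ _ (fun x => (c ^+ l / l`!%:R) * damped c l x)).
- by move=> w; rewrite /pois /damped /exp_coeff /= exprMn; ring.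
- by move=> w; rewrite /pois /damped /exp_coeff /= exprMn; ring.
- by apply: (agreeZ _ _ _ _ bG bH); exact: agree_damped.
Qed.

Lemma agree_setC (B : set R) : agree (fun=> 1) ->
  agree (\1_B : R -> R) -> agree (\1_(~` B) : R -> R).
Proof.
move=> a1 aB; apply: (@eq_agree _ _ _ _ _ _ _ _ _ (fun x => 1 + -1 * \1_B x)).
- by move=> w; rewrite indicC indicE mulN1r; case: (_ \in _); rewrite ?subrr ?subr0.
- by move=> w; rewrite indicC indicE mulN1r; case: (_ \in _); rewrite ?subrr ?subr0.
- by apply: (agreeD _ _ _ _ bG bH) => //; exact: (agreeZ _ _ _ _ bG bH).
Qed.

(** The rays ]x, +oo[ form a pi-system generating the Borel sets, and the indicators of their
    complements are limits of [poisson_cutoff]. The constant 1, the sum of all weights, gives equal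
    total masses and thereby lets complements through. *)
Lemma agree_pois_indic : (forall l, agree (pois l)) ->
  forall B : set R, measurable B -> agree (\1_B : R -> R).
Proof.
move=> ap.
have a1 : agree (fun=> 1).
  apply: (agree_lim_ge0 (fun n x => \sum_(l < n) pois l x) _ 1) => [n|n x x0|x _].
  - by apply: (agree_sum _ _ _ _ bG bH).
  - by rewrite ger0_norm ?sum_pois_ge0// sum_pois_le1.
  - exact: cvg_sum_pois.
have aray t : agree (\1_(`]-oo, t]%classic) : R -> R).
  (* Cutoffs converge only for nonnegative thresholds; for negative ones both indicators vanish, [X]
     and [Y] being nonnegative. *)
  have [t0|t0] := ltP t 0.
    apply: (@eq_agree _ _ _ _ _ _ _ _ _ (fun=> 0)).
    - move=> w; rewrite indicE memNset//= in_itv /=.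
      by apply/negP; rewrite -ltNge (lt_le_trans t0).
    - move=> w; rewrite indicE memNset//= in_itv /=.
      by apply/negP; rewrite -ltNge (lt_le_trans t0).
    - exact: (agree0 _ _ _ _ ).
  apply: (agree_lim_ge0 (poisson_cutoff t) _ 1) => [n|n x x0|x x0].
  - exact: agree_poisson_cutoff.
  - by have /andP[f0 f1] := poisson_cutoff_itv t n x x0; rewrite ger0_norm.
  - rewrite indicE (_ : (x \in _) = (x <= t)); first exact: cvg_poisson_cutoff.
    by apply/idP/idP => [/set_mem|xt]; [|apply/mem_set]; rewrite /= in_itv.
move=> B mB.
apply: (@dynkin_induction _ _ (@RGenOInfty.G R)
    (fun B => agree (\1_B : R -> R))).
- exact: RGenOInfty.measurableE.
- move=> _ _ [x ->] [y ->]; exists (Num.max x y).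
  by apply/seteqP; split=> z /=; rewrite !in_itv /= !andbT gt_max => /andP.
- by rewrite indicT.
- by move=> _ [x ->]; rewrite -setCitvl; exact: agree_setC.
- by move=> S _; exact: agree_setC.
- move=> F mF tF aF.
  have sumE n x : (\sum_(i < n) \1_(F i) x)%:E =
      (\sum_(0 <= i < n) (\1_(F i) x)%:E)%E :> \bar R.
    by rewrite sumEFin big_mkord.
  apply: (agree_lim_ge0 (fun n x => \sum_(i < n) \1_(F i) x) _ 1) => [n|n x _|x _].
  + by apply: (agree_sum _ _ _ _ bG bH).
  + rewrite ger0_norm; last by apply: sumr_ge0 => i _.
    rewrite -lee_fin sumE; apply: (@le_trans _ _ (\1_(\bigcup_i F i) x)%:E).
      by rewrite indic_bigcup//; apply: nneseries_lim_ge => i _; rewrite lee_fin.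
    by rewrite lee_fin indicE; case: (_ \in _).
  + apply: (@fine_cvg _ _ _ _ (fun n => (\sum_(i < n) \1_(F i) x)%:E)).
    under eq_fun do rewrite sumE.
    by rewrite indic_bigcup//; apply: is_cvg_nneseries => i _ _; rewrite lee_fin.
(* The Borel sets and the sigma-algebra generated by the rays are equal as families of sets, and
   membership is transported along this equality. *)
- exact: (eq_ind _ (fun S => S B) mB _ (RGenOInfty.measurableE R)).
Qed.

End determination.

(** * From indicators to bounded measurable functions *)

Section approximation.
Context {d : measure_display} {T : measurableType d} {R : realType}
  {P : probability T R}.
Variables (X Y : T -> R) (G H : T -> R).
Hypotheses (X0 : forall w, 0 <= X w) (Y0 : forall w, 0 <= Y w).
Hypotheses (bG : bounded_mfun G) (bH : bounded_mfun H).

Local Notation agree := (@agree _ T R P R X Y G H).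

(** Simple functions increase to [f] on [0, +oo[. Sign and bound are required only there, since a
    Poisson weight may be negative or unbounded at negative arguments. *)
Lemma agree_indic_nonneg (f : R -> R) (M : R) : measurable_fun setT f ->
  (forall x, 0 <= x -> 0 <= f x <= M) ->
  (forall B : set R, measurable B -> agree (\1_B : R -> R)) -> agree f.
Proof.
move=> mf fM aB; pose D : set R := `[0, +oo[%classic.
have mD : measurable D by exact: measurable_itv.
have mfD : measurable_fun D (EFin \o f).
  by apply/measurable_EFinP; exact: measurable_funTS.
pose h := nnsfun_approx mD mfD.
have f0 x : D x -> (0 <= (EFin \o f) x)%E.
  by rewrite /D /= in_itv /= andbT lee_fin => /fM /andP[].
have cvh x : 0 <= x -> h n x @[n --> \oo] --> f x.
  move=> x0; have Dx : D x by rewrite /D /= in_itv /= x0.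
  by have /fine_cvg := cvg_nnsfun_approx mD mfD f0 Dx.
have ndh x : nondecreasing_seq (fun n => h n x).
  by move=> m n mn; have /lefP := nd_nnsfun_approx mD mfD mn; exact.
apply: (agree_lim_ge0 _ _ _ _ X0 Y0 bG bH (fun n => h n) _ M) => [n|n x x0|//].
  have -> : (h n : R -> R) = fun x =>
      \sum_(y <- finmap.enum_fset (fset_set (range (h n))))
        y * \1_(h n @^-1` [set y]) x.
    by apply/funext => x; rewrite [LHS]fimfunE fsbig_finite.
  apply: (agree_sum _ _ _ _ bG bH) => y; apply: (agreeZ _ _ _ _ bG bH).
  by apply: aB; exact: measurable_funPTI.
rewrite ger0_norm//; have /andP[_] := fM _ x0; apply: le_trans.
rewrite -(cvg_lim _ (cvh x x0))//; apply: nondecreasing_cvgn_le => //.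
by apply: cvgP; exact: cvh.
Qed.

End approximation.

(** * Determination by single points of a countable type *)

Section discrete.
Context {d : measure_display} {T : measurableType d} {R : realType}
  {P : probability T R} {V : countType}.
Variables (X Y : T -> V) (G H : T -> R).
Hypotheses (bG : bounded_mfun G) (bH : bounded_mfun H).

Local Notation agree := (@agree _ T R P V X Y G H).

(** Enumeration by [pickle]: the part of [S] with codes below [n] gains at most one point when [n]
    increases by 1, and exhausts [S] in the limit. *)
Lemma agree_discrete : (forall y, agree (\1_[set y] : V -> R)) ->
  forall S : set V, agree (\1_S : V -> R).
Proof.
move=> aP S.
pose F n : V -> R := \1_[set v | S v /\ (pickle v < n)%N].
have FE n v : F n v = (`[< S v >] && (pickle v < n)%N)%:R.
  rewrite /F indicE; congr ((_ : bool)%:R).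
  apply/idP/idP => [/set_mem[/= Sv vn]|/andP[/asboolP Sv vn]].
    by rewrite vn andbT; apply/asboolP.
  exact/mem_set.
have cvF v : F n v @[n --> \oo] --> (\1_S v : R).
  apply: cvg_near_cst; exists (pickle v).+1 => // n /= vn.
  by rewrite FE vn andbT indicE.
have F1 n v : `|F n v| <= 1.
  by rewrite FE; case: (_ && _); rewrite ?normr1 ?normr0.
apply: (agree_lim _ _ _ _ bG bH F _ 1) => // n.
elim: n => [|n IH].
  apply: (@eq_agree _ _ _ _ _ _ _ _ _ (fun=> 0)).
  - by move=> w; rewrite FE ltn0 andbF.
  - by move=> w; rewrite FE ltn0 andbF.
  - exact: agree0.
have [[y [Sy yn]]|nS] := pselect (exists y, S y /\ pickle y = n).
  have FS v : F n v + \1_[set y] v = F n.+1 v.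
    rewrite !FE indicE ltnS (leq_eqVlt (pickle v)) -yn.
    have [<-|vy] := eqVneq y v.
      by rewrite eqxx ltnn andbF add0r mem_set// (asboolT Sy).
    rewrite memNset ?addr0 /=; last by move=> e; rewrite e eqxx in vy.
    rewrite (negbTE (_ : pickle v != pickle y))//.
    by apply: contraNneq vy => /(pcan_inj pickleK) ->.
  apply: (@eq_agree _ _ _ _ _ _ _ _ _ (fun v => F n v + \1_[set y] v)) => //.
  by apply: (agreeD _ _ _ _ bG bH).
suff -> : F n.+1 = F n by [].
apply/funext => v; rewrite !FE ltnS (leq_eqVlt (pickle v)); congr ((_ : bool)%:R).
case: asboolP => //= Sv; case: eqP => //= vn.
by exfalso; apply: nS; exists v.
Qed.

End discrete.

Section product_rule.
Context {d : measure_display} {T : measurableType d} {R : realType}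
  {P : probability T R}.
Variables (A B : nat -> (T -> R) -> Prop) (n : nat).
Hypotheses (bA : forall i f, (i < n)%N -> A i f -> bounded_mfun f)
  (bB : forall i f, (i < n)%N -> B i f -> bounded_mfun f).

(* One coordinate is moved from the class A to the class B at a time: the other
   factors are absorbed in the weight G, and their means in the constant H. *)
Lemma product_rule :
  (forall (i : nat) (G H : T -> R), (i < n)%N ->
    bounded_mfun G -> bounded_mfun H ->
    (forall f, A i f -> \int[P]_w (f w * G w) = \int[P]_w (f w * H w)) ->
    forall f, B i f -> \int[P]_w (f w * G w) = \int[P]_w (f w * H w)) ->
  (forall g : nat -> T -> R, (forall i, (i < n)%N -> A i (g i)) ->
    \int[P]_w (\prod_(i < n) g i w) = \prod_(i < n) \int[P]_w g i w) ->
  forall g : nat -> T -> R, (forall i, (i < n)%N -> B i (g i)) ->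
    \int[P]_w (\prod_(i < n) g i w) = \prod_(i < n) \int[P]_w g i w.
Proof.
move=> AB prodA.
suff h (j : nat) : (j <= n)%N -> forall g : nat -> T -> R,
    (forall i, (i < n)%N -> if (i < j)%N then B i (g i) else A i (g i)) ->
    \int[P]_w (\prod_(i < n) g i w) = \prod_(i < n) \int[P]_w g i w.
  by move=> g Bg; apply: (h n) => // i ni; rewrite ni; exact: Bg.
elim: j => [_ g Ag|j IH jn g hg].
  by apply: prodA => i ni; exact: Ag.
have bg i : (i < n)%N -> bounded_mfun (g i).
  by move=> ni; have := hg i ni; case: ifP => _; [exact: bB|exact: bA].
pose J := Ordinal jn.
pose G w := \prod_(i < n | i != J) g i w.
pose C := \prod_(i < n | i != J) \int[P]_w g i w.
have bG : bounded_mfun G by apply: bounded_mfun_prod => i _; exact: bg.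
have EC f : bounded_mfun f -> \int[P]_w (f w * C) = \int[P]_w f w * C.
  by move=> bf; under eq_Rintegral do rewrite mulrC; rewrite meanZ// mulrC.
rewrite (bigD1 J)//= -/C -EC; last exact: bg.
under eq_Rintegral do rewrite (bigD1 J)//= -/(G _).
apply: (AB j) => //; first exact: bounded_mfun_cst; last first.
  by have := hg j jn; rewrite ltnSn.
(* With [f] of class [A] at coordinate [j], the family falls under the induction hypothesis, and its
   product rule is exactly the required identity between the weights [G] and [C]. *)
move=> f Af; pose g' i := if i == j then f else g i.
have g'J : g' j = f by rewrite /g' eqxx.
have g'N (i : 'I_n) : i != J -> g' i = g i.
  by rewrite /g' -val_eqE /= => /negbTE ->.
have {}IH := IH (ltnW jn) g'.
rewrite EC; last exact: (bA j).
transitivity (\int[P]_w (\prod_(i < n) g' i w)).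
  apply: eq_Rintegral => w _; rewrite (bigD1 J)//= g'J; congr (_ * _).
  by apply: eq_bigr => i iJ; rewrite g'N.
rewrite IH; last first.
  move=> i ni; rewrite /g'; case: eqVneq => [->|ij]; first by rewrite ltnn.
  by have := hg i ni; rewrite ltnS leq_eqVlt (negbTE ij).
rewrite (bigD1 J)//= g'J; congr (_ * _).
by apply: eq_bigr => i iJ; rewrite g'N.
Qed.

End product_rule.

(** * Independence *)

Section independence.
Context {d : measure_display} {T : measurableType d} {R : realType}
  {P : probability T R}.

Lemma prod_indic (n : nat) (A : nat -> set T) (w : T) :
  \prod_(i < n) \1_(A i) w = \1_(\bigcap_(i < n) A i) w :> R.
Proof.
have [wA|/existsNP[i /not_implyP[/= ni nA]]] := pselect ((\bigcap_(i < n) A i) w).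
  rewrite [RHS]indicE mem_set// big1// => i _.
  by rewrite indicE mem_set//; exact: wA (ltn_ord i).
rewrite [RHS]indicE memNset; last by move=> /(_ i ni).
by rewrite (bigD1 (Ordinal ni))//= indicE memNset// mul0r.
Qed.

Lemma prob_mean_indic (A : set T) : measurable A -> P A = (\int[P]_w \1_A w)%:E.
Proof. by move=> mA; rewrite mean_indic// fineK//; exact: fin_num_measure. Qed.

Lemma prod_prob (n : nat) (A : nat -> set T) :
  (forall i, (i < n)%N -> measurable (A i)) ->
  (P (\bigcap_(i < n) A i) = \prod_(i < n) P (A i))%E <->
  \int[P]_w (\prod_(i < n) \1_(A i) w) = \prod_(i < n) \int[P]_w (\1_(A i) w) :> R.
Proof.
move=> mA; have mcap : measurable (\bigcap_(i < n) A i).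
  by apply: bigcap_measurableType => i; exact: mA.
rewrite prob_mean_indic// (_ : (\prod_(i < n) P (A i))%E
    = (\prod_(i < n) \int[P]_w (\1_(A i) w))%:E); last first.
  by rewrite -prodEFin; apply: eq_bigr => i _; rewrite prob_mean_indic//; exact: mA.
under [X in _ <-> X = _]eq_Rintegral do rewrite prod_indic.
by split=> [[]|->].
Qed.

(** In each exchange the two variables compared are the same [X i], and only the densities [G] and
    [H] differ; [agree_pois_indic] and [agree_indic_nonneg] give the two directions. *)
Lemma independent_pois (n : nat) (X : nat -> T -> R) :
  (forall i, (i < n)%N -> measurable_fun setT (X i)) ->
  (forall i w, (i < n)%N -> 0 <= X i w) ->
  (forall B : nat -> set R, (forall i, (i < n)%N -> measurable (B i)) ->
    (P (\bigcap_(i < n) X i @^-1` B i) = \prod_(i < n) P (X i @^-1` B i))%E)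
  <-> (forall l : nat -> nat,
    \int[P]_w (\prod_(i < n) pois (l i) (X i w)) =
    \prod_(i < n) \int[P]_w pois (l i) (X i w)).
Proof.
move=> mX X0.
have mpre i (B : set R) : (i < n)%N -> measurable B -> measurable (X i @^-1` B).
  by move=> ni mB; rewrite -[_ @^-1` _]setTI; exact: mX.
have mpois := @measurable_pois R.
pose BB i (f : T -> R) := exists2 B, measurable B & f = \1_(X i @^-1` B).
pose PP i (f : T -> R) := exists l, f = fun w => pois l (X i w).
have bB i f : (i < n)%N -> BB i f -> bounded_mfun f.
  by move=> ni [B mB ->]; apply: bounded_mfun_indic; exact: mpre.
have bP i f : (i < n)%N -> PP i f -> bounded_mfun f.
  by move=> ni [l ->]; apply: bounded_mfun_pois => [|w]; [exact: mX|exact: X0].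
split=> [ind l|ind B mB].
- apply: (product_rule BB PP n bB bP _ _ (fun i w => pois (l i) (X i w)))
      => [i G H ni bG bH hB f [m ->]|g Bg|i ni].
  + have X0i w := X0 i w ni.
    have [||_ _] //:= @agree_indic_nonneg _ _ _ P _ _ _ _ X0i X0i bG bH
      (pois m) 1 (mpois m).
      by move=> x x0; rewrite pois_ge0// pois_le1.
    move=> B mB; split; [by apply: (bB i) => //; exists B..|].
    by apply: (hB \1_(X i @^-1` B)); exists B.
  + have /choice[B gE] i : exists C, (i < n)%N ->
        measurable C /\ g i = \1_(X i @^-1` C).
      have [ni|ni] := ltnP i n; last by exists setT.
      by have [C mC ->] := Bg i ni; exists C.
    transitivity (\int[P]_w (\prod_(i < n) \1_(X i @^-1` B i) w)).
      by apply: eq_Rintegral => w _; apply: eq_bigr => i _; rewrite (gE i _).2.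
    transitivity (\prod_(i < n) \int[P]_w (\1_(X i @^-1` B i) w)); last first.
      by apply: eq_bigr => i _; rewrite (gE i _).2.
    apply/(prod_prob n (fun i => X i @^-1` B i)) => [i ni|].
      by apply: mpre => //; exact: (gE i ni).1.
    by apply: ind => i ni; exact: (gE i ni).1.
  + by exists (l i).
- apply/(prod_prob n (fun i => X i @^-1` B i)) => [i ni|].
    by apply: mpre => //; exact: mB.
  apply: (product_rule PP BB n bP bB _ _ (fun i => \1_(X i @^-1` B i)))
      => [i G H ni bG bH hP f [C mC ->]|g Pg|i ni].
  + have X0i w := X0 i w ni.
    have [] // := @agree_pois_indic _ _ _ P _ _ _ _ X0i X0i bG bH _ C mC.
    move=> m; split; [by apply: (bP i) => //; exists m..|].
    by apply: (hP (fun w => pois m (X i w))); exists m.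
  + have /choice[l gE] i : exists l, (i < n)%N -> g i = fun w => pois l (X i w).
      have [ni|ni] := ltnP i n; last by exists 0%N.
      by have [l ->] := Pg i ni; exists l.
    transitivity (\int[P]_w (\prod_(i < n) pois (l i) (X i w))).
      by apply: eq_Rintegral => w _; apply: eq_bigr => i _; rewrite (gE i).
    by rewrite ind; apply: eq_bigr => i _; rewrite (gE i).
  + by exists (B i) => //; exact: mB.
Qed.

End independence.

(** * Independence of variables with countably many values *)

Section discrete_independence.
Context {d : measure_display} {T : measurableType d} {R : realType}
  {P : probability T R} {V : countType}.

(** [V] carries no sigma-algebra, so measurability is expressed by fibres; every preimage is a
    countable union of them. *)
Lemma measurable_preimage_discrete (Y : T -> V) (S : set V) :
  (forall y, measurable (Y @^-1` [set y])) -> measurable (Y @^-1` S).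
Proof.
move=> mY; rewrite (_ : Y @^-1` S = \bigcup_(k in [set: nat])
    [set w | S (Y w) /\ pickle (Y w) = k]); last first.
  by apply/seteqP; split=> [w SYw|w [k _ [SYw _]]//]; exists (pickle (Y w)).
apply: bigcup_measurable => k _.
have [[y [Sy yk]]|nS] := pselect (exists y, S y /\ pickle y = k).
  rewrite (_ : mkset _ = Y @^-1` [set y])//; apply/seteqP; split=> [w [_]|w /= ->//].
  by rewrite -yk => /(pcan_inj pickleK).
rewrite (_ : mkset _ = set0)//; apply/seteqP; split=> // w [SYw Yk].
by apply: nS; exists (Y w).
Qed.

(** Meant for vectors of counts: it carries the product rule from single vectors to the sets of
    vectors that describe arrival events. *)
Lemma independent_discrete (n : nat) (Y : nat -> T -> V) :
  (forall i y, (i < n)%N -> measurable (Y i @^-1` [set y])) ->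
  (forall y : nat -> V,
    (P (\bigcap_(i < n) Y i @^-1` [set y i]) =
     \prod_(i < n) P (Y i @^-1` [set y i]))%E) ->
  forall S : nat -> set V,
    (P (\bigcap_(i < n) Y i @^-1` S i) = \prod_(i < n) P (Y i @^-1` S i))%E.
Proof.
move=> mY ind S.
have mYS i (C : set V) : (i < n)%N -> measurable (Y i @^-1` C).
  by move=> ni; apply: measurable_preimage_discrete => y; exact: mY.
pose BB i (f : T -> R) := exists C, f = \1_(Y i @^-1` C).
pose AA i (f : T -> R) := exists y, f = \1_(Y i @^-1` [set y]).
have bA i f : (i < n)%N -> AA i f -> bounded_mfun f.
  by move=> ni [y ->]; apply: bounded_mfun_indic; exact: mYS.
have bB i f : (i < n)%N -> BB i f -> bounded_mfun f.
  by move=> ni [y ->]; apply: bounded_mfun_indic; exact: mYS.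
apply/(prod_prob n (fun i => Y i @^-1` S i)) => [i ni|]; first exact: mYS.
apply: (product_rule AA BB n bA bB _ _ (fun i => \1_(Y i @^-1` S i)))
    => [i G H ni bG bH hP f [C ->]|g Ag|i ni].
- have [|_ _] // := @agree_discrete _ _ _ P _ (Y i) (Y i) G H bG bH _ C.
  move=> y; split; [by apply: (bA i) => //; exists y..|].
  by apply: (hP \1_(Y i @^-1` [set y])); exists y.
(* [V] could be empty, so a default value [y0] is available only if there is a factor to take it
   from. *)
- have [n0|n0] := posnP n.
    by rewrite n0; under eq_Rintegral do rewrite big_ord0; rewrite big_ord0 mean_cst.
  have [y0 _] := Ag 0%N n0.
  have /choice[y gE] i : exists y, (i < n)%N -> g i = \1_(Y i @^-1` [set y]).
    have [ni|ni] := ltnP i n; last by exists y0.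
    by have [y ->] := Ag i ni; exists y.
  transitivity (\int[P]_w (\prod_(i < n) \1_(Y i @^-1` [set y i]) w)).
    by apply: eq_Rintegral => w _; apply: eq_bigr => i _; rewrite (gE i).
  transitivity (\prod_(i < n) \int[P]_w (\1_(Y i @^-1` [set y i]) w)); last first.
    by apply: eq_bigr => i _; rewrite (gE i).
  by apply/(prod_prob n (fun i => Y i @^-1` [set y i])) => [i ni|//]; exact: mYS.
- by exists (S i).
Qed.

End discrete_independence.

(** * Paths of counting processes *)

Section counting_paths.
Context {d : measure_display} {T : measurableType d} {R : realType}
  {P : probability T R}.
Variable N : R -> {RV P >-> nat}.
Hypothesis N_pp : point_process N.

(** Integer values closer than 1 are equal, so right continuity makes the path locally constant to
    the right. *)
Lemma count_right_continuous (w : T) (t : R) : 0 <= t ->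
  \forall s \near t^'+, N s w = N t w.
Proof.
move=> t0; have [_ cN _] := N_pp; have [/(_ t t0) rc _] := cN w.
move/cvgrPdist_lt : rc => /(_ 1 ltr01); apply: filterS => s.
rewrite ltr_norml => /andP[h1 h2].
apply/eqP; rewrite eqn_leq -!(ltnS (N _ _)) -!(ltr_nat R) -!natr1.
by apply/andP; split; lra.
Qed.

Lemma cvg_count (w : T) (t : R) (u : nat -> R) : 0 <= t ->
  (forall n, t < u n) -> u n @[n --> \oo] --> t ->
  \forall n \near \oo, N (u n) w = N t w.
Proof.
move=> t0 tu ut; have [e /= e0 he] := count_right_continuous w t t0.
move/cvgrPdist_lt : ut => /(_ e e0); apply: filterS => n un.
by apply: he => //; rewrite /ball_ /=; exact: un.
Qed.

(** The infimum is attained: if [N u w < i], the path keeps its value on an interval to the right of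
    [u], so no time with at least [i] points lies below u + e / 2. *)
Lemma arrival_le (i : nat) (w : T) (u : R) : 0 <= u ->
  (arrival N i w <= u%:E)%E <-> (i <= N u w)%N.
Proof.
move=> u0; have [_ _ ndN] := N_pp; split=> [|iN]; last first.
  by apply: ereal_inf_lbound; exists u.
apply: contraPP => /negP; rewrite -ltnNge => Ni.
have [e /= e0 he] := count_right_continuous w u u0.
apply/negP; rewrite -ltNge; apply: (@lt_le_trans _ _ (u + e / 2)%:E).
  by rewrite lte_fin ltrDl divr_gt0.
apply: le_ereal_inf_tmp => _ [t [t0 it] <-]; rewrite lee_fin leNgt; apply/negP => tu.
have : (N t w <= N u w)%N; last by rewrite leqNgt (leq_trans Ni).
have [tu'|tu'] := leP t u; first exact: ndN.
rewrite (he t)//= /ball_ /= distrC gtr0_norm; lra.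
Qed.

Lemma incrN_le (w : T) (s t : R) : 0 <= s -> s <= t ->
  (incrN N s t w + N s w)%N = N t w.
Proof. by move=> s0 st; have [_ _ ndN] := N_pp; rewrite subnK// ndN. Qed.

Lemma measurable_incrN (s t : R) (S : set nat) : measurable (incrN N s t @^-1` S).
Proof. by rewrite -[_ @^-1` _]setTI; apply: measurable_fun_subn. Qed.

End counting_paths.

(** * Cox processes *)

Lemma leq_steps_homo {R : realType} (n : nat) (s : nat -> R) :
  (forall i, (i < n)%N -> s i <= s i.+1) ->
  forall i j, (i <= j)%N -> (j <= n)%N -> s i <= s j.
Proof.
move=> hs i; elim=> [|j IH]; first by rewrite leqn0 => /eqP ->.
rewrite leq_eqVlt => /predU1P[-> //|ij jn].
by apply: le_trans (hs j jn); apply: IH => //; exact: ltnW.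
Qed.

Section cox.
Context {d : measure_display} {T : measurableType d} {R : realType}
  {P : probability T R}.
Variables (eta : R -> {RV P >-> R}) (N : R -> {RV P >-> nat}).
Hypothesis eta_nd : forall w : T, nondecreasing_path (fun t => eta t w).
Hypothesis N_cox : cox_process eta N.

(** At mean 0 the Dirac mass at 0 agrees with [pois l 0], because 0^0 = 1. *)
Lemma poisson_prob_set1 (x : R) (l : nat) : 0 <= x ->
  poisson_prob x 0%N [set l] = (pois l x)%:E.
Proof.
rewrite le_eqVlt => /predU1P[<-|x0].
  rewrite /poisson_prob ltxx diracE /pois /exp_coeff /= oppr0 expR0 mul1r.
  congr (_%:E); case: l => [|l].
    by rewrite expr0 fact0 divr1 mem_set.
  by rewrite expr0n /= mul0r memNset.
rewrite /poisson_prob x0 esum_set1 ?lee_fin ?poisson_pmf_ge0// /poisson_pmf x0.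
by congr (_%:E); rewrite /pois /exp_coeff /= mulrC.
Qed.

Lemma incr_ge0 (s t : R) w : 0 <= s -> s <= t -> 0 <= incr eta s t w.
Proof. by move=> s0 st; rewrite subr_ge0; exact: eta_nd. Qed.

Lemma measurable_incr (s t : R) : measurable_fun setT (incr eta s t).
Proof. exact: measurable_funB. Qed.

(** The conditional probability is integrated over the whole space. Times may coincide, since an
    empty interval is disjoint from all others. *)
Lemma cox_counts (n : nat) (s : nat -> R) (l : nat -> nat) : 0 <= s 0%N ->
  (forall i, (i < n)%N -> s i <= s i.+1) ->
  P (\bigcap_(i < n) (incrN N (s i) (s i.+1) @^-1` [set l i])) =
  (\int[P]_w (\prod_(i < n) pois (l i) (incr eta (s i) (s i.+1) w)))%:E.
Proof.
move=> s0 hs; have hom := leq_steps_homo n s hs.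
have s_ge0 i : (i <= n)%N -> 0 <= s i.
  by move=> ni; apply: le_trans s0 _; exact: hom.
have [_ /(_ n (fun i => s i) (fun i => s i.+1) (fun i => l i)) cond] := N_cox.
have [||_ /(_ setT)] := cond.
- by move=> i; rewrite s_ge0 ?hs// ltnW.
- apply/trivIsetP => -[i ni] [j nj] _ _; rewrite -val_eqE /= => ij.
  rewrite -subset0 => x /=; rewrite !in_itv /=.
  have lt_case a b : (a < b)%N -> (b < n)%N -> x <= s a.+1 -> s b < x -> False.
    move=> ab bn xa bx; have := hom a.+1 b ab (ltnW bn).
    by rewrite leNgt (lt_le_trans bx xa).
  move=> [/andP[ix xi] /andP[jx xj]].
  move: ij; rewrite neq_ltn => /orP[ij|ij].
    exact: (lt_case i j).
  exact: (lt_case j i).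
have GT : process_sigma eta setT.
  by rewrite -(setD0 setT); apply: sigma_algebraCD; exact: sigma_algebra0.
move=> /(_ GT); rewrite setTI => cE.
transitivity (P [set w | forall i : 'I_n, incrN N (s i) (s i.+1) w = l i]).
  congr (P _); apply/seteqP; split=> [w h i|w h i ni]; first exact: h i (ltn_ord i).
  exact: (h (Ordinal ni)).
rewrite cE /Rintegral fineK; last first.
  apply: integrable_fin_num => //; apply: bounded_mfun_integrable.
  apply: bounded_mfun_prod => i _; apply: bounded_mfun_pois.
    exact: measurable_incr.
  by move=> w; rewrite incr_ge0 ?s_ge0 ?hs// ltnW.
apply: eq_integral => w _; rewrite -prodEFin; apply: eq_bigr => i _.
by rewrite poisson_prob_set1// incr_ge0 ?s_ge0 ?hs// ltnW.
Qed.

Lemma cox_count (s t : R) (l : nat) : 0 <= s -> s <= t ->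
  P (incrN N s t @^-1` [set l]) = (\int[P]_w pois l (incr eta s t w))%:E.
Proof.
move=> s0 st; pose u i := if i is 0%N then s else t.
have := @cox_counts 1 u (fun=> l) s0.
rewrite (_ : \bigcap_(i < 1) _ = incrN N s t @^-1` [set l]); last first.
  by apply/seteqP; split=> [w /(_ 0%N erefl)//|w h [|i]//].
move=> ->; last by case.
by congr (_%:E); apply: eq_Rintegral => w _; rewrite big_ord1.
Qed.

(** The means provided by [cox_counts] turn the product rule for counts into the Poisson side of
    [independent_pois]. *)
Lemma counts_independent_incr (n : nat) (s : nat -> R) : 0 <= s 0%N ->
  (forall i, (i < n)%N -> s i <= s i.+1) ->
  (forall l : nat -> nat,
    P (\bigcap_(i < n) (incrN N (s i) (s i.+1) @^-1` [set l i])) =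
    (\prod_(i < n) P (incrN N (s i) (s i.+1) @^-1` [set l i]))%E) <->
  (forall B : nat -> set R, (forall i, (i < n)%N -> measurable (B i)) ->
    P (\bigcap_(i < n) (incr eta (s i) (s i.+1) @^-1` B i)) =
    (\prod_(i < n) P (incr eta (s i) (s i.+1) @^-1` B i))%E).
Proof.
move=> s0 hs; have hom := leq_steps_homo n s hs.
have s_ge0 i : (i <= n)%N -> 0 <= s i.
  by move=> ni; apply: le_trans s0 _; exact: hom.
rewrite independent_pois; last 2 first.
- by move=> i _; exact: measurable_incr.
- by move=> i w ni; apply: incr_ge0; [exact/s_ge0/ltnW|exact: hs].
split=> h l.
- have := h l; rewrite cox_counts//.
  under eq_bigr => i _ do rewrite cox_count ?s_ge0 ?hs ?(ltnW (ltn_ord i))//.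
  by rewrite prodEFin => -[].
- rewrite cox_counts//.
  under eq_bigr => i _ do rewrite cox_count ?s_ge0 ?hs ?(ltnW (ltn_ord i))//.
  by rewrite prodEFin h.
Qed.

(* Coinciding times are reached as limits of strictly increasing ones, by right
   continuity of N. *)
Lemma counts_independent_weak :
  (forall (n : nat) (s : nat -> R) (l : nat -> nat), 0 <= s 0%N ->
    (forall i, (i < n)%N -> s i < s i.+1) ->
    P (\bigcap_(i < n) (incrN N (s i) (s i.+1) @^-1` [set l i])) =
    (\prod_(i < n) P (incrN N (s i) (s i.+1) @^-1` [set l i]))%E) ->
  forall (n : nat) (s : nat -> R) (l : nat -> nat), 0 <= s 0%N ->
    (forall i, (i < n)%N -> s i <= s i.+1) ->
    P (\bigcap_(i < n) (incrN N (s i) (s i.+1) @^-1` [set l i])) =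
    (\prod_(i < n) P (incrN N (s i) (s i.+1) @^-1` [set l i]))%E.
Proof.
move=> strict n s l s0 hs; have hom := leq_steps_homo n s hs.
have [N_pp _] := N_cox.
have s_ge0 i : (i <= n)%N -> 0 <= s i.
  by move=> ni; apply: le_trans s0 _; exact: hom.
(* Adding i / (m + 1) makes the times strictly increasing, keeps the first one, and approaches [s i]
   from the right, the side on which the paths are continuous. *)
pose u m i := s i + i%:R * m.+1%:R^-1.
have us m i : (i < n)%N -> u m i < u m i.+1.
  move=> ni; apply: ler_ltD; first exact: hs.
  by rewrite ltr_pM2r ?invr_gt0// ltr_nat.
have u0 m : 0 <= u m 0%N by rewrite /u mul0r addr0.
have uE i w : (i <= n)%N -> \forall m \near \oo, N (u m i) w = N (s i) w.
  case: i => [|i] ni; first by apply: nearW => m; rewrite /u mul0r addr0.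
  apply: cvg_count => //; first exact: s_ge0.
  - by move=> m; rewrite ltrDl mulr_gt0// invr_gt0.
  - suff : u m i.+1 @[m --> \oo] --> s i.+1 + i.+1%:R * 0 by rewrite mulr0 addr0.
    apply: cvgD; first exact: cvg_cst.
    by apply: cvgM; [exact: cvg_cst|exact: cvg_harmonic].
pose A m i := incrN N (u m i) (u m i.+1) @^-1` [set l i].
pose A0 i := incrN N (s i) (s i.+1) @^-1` [set l i].
have mA m i : measurable (A m i) by exact: measurable_incrN.
have mA0 i : measurable (A0 i) by exact: measurable_incrN.
have cvA i w : (i < n)%N -> \1_(A m i) w @[m --> \oo] --> (\1_(A0 i) w : R).
  move=> ni; apply: cvg_near_cst.
  apply: filterS2 (uE i w (ltnW ni)) (uE i.+1 w ni) => m h h'.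
  have e : incrN N (u m i) (u m i.+1) w = incrN N (s i) (s i.+1) w.
    by rewrite /incrN h h'.
  rewrite !indicE; congr ((nat_of_bool _)%:R).
  by apply/idP/idP => /set_mem; rewrite /A /A0 /preimage /= => Aw; apply/mem_set;
    move: Aw; rewrite /= e.
have cvE i : (i < n)%N ->
    \int[P]_w \1_(A m i) w @[m --> \oo] --> \int[P]_w (\1_(A0 i) w : R).
  move=> ni; apply: (mean_bounded_cvg _ _ 1) => [m|m w|w].
  - exact: measurable_indic.
  - by rewrite indicE; case: (_ \in _); rewrite ?normr1 ?normr0.
  - exact: cvA.
have cvprod (F : nat -> nat -> R) (F0 : nat -> R) :
    (forall i, (i < n)%N -> F m i @[m --> \oo] --> F0 i) ->
    \prod_(i < n) F m i @[m --> \oo] --> \prod_(i < n) F0 i.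
  by move=> cF; apply: cvg_big => [|i _]; [exact: mul_continuous|exact: cF].
apply/(prod_prob n A0) => //.
have limE : \int[P]_w (\prod_(i < n) \1_(A m i) w) @[m --> \oo] -->
    \int[P]_w (\prod_(i < n) (\1_(A0 i) w : R)).
  apply: (mean_bounded_cvg _ _ 1) => [m|m w|w].
  - have [] // : bounded_mfun (fun w => \prod_(i < n) \1_(A m i) w : R).
    apply: (bounded_mfun_prod _ _ _ (fun i : 'I_n => \1_(A m i))) => i _.
    exact: bounded_mfun_indic.
  - by rewrite prod_indic indicE; case: (_ \in _); rewrite ?normr1 ?normr0.
  - apply: (cvprod (fun m i => \1_(A m i) w) (fun i => \1_(A0 i) w)) => i ni.
    exact: cvA.
have limP := cvprod (fun m i => \int[P]_w \1_(A m i) w) _ cvE.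
rewrite -(cvg_lim _ limE)// -(cvg_lim _ limP)//; congr (limn _).
apply/funext => m.
by apply/(prod_prob n (A m)) => //; apply: strict => // i; exact: us.
Qed.

End cox.

(** * Equality in law *)

Section equality_in_law.
Context {d : measure_display} {T : measurableType d} {R : realType}
  {P : probability T R}.

(** Here both densities are 1 and the two variables differ, the opposite of the situation in
    [independent_pois]. *)
Lemma eq_law_pois (X Y : T -> R) :
  measurable_fun setT X -> measurable_fun setT Y ->
  (forall w, 0 <= X w) -> (forall w, 0 <= Y w) ->
  (forall B : set R, measurable B -> P (X @^-1` B) = P (Y @^-1` B)) <->
  (forall l, \int[P]_w pois l (X w) = \int[P]_w pois l (Y w)).
Proof.
move=> mX mY X0 Y0; have b1 := bounded_mfun_cst (T := T) (1 : R).
have mpre (Z : T -> R) (B : set R) : measurable_fun setT Z -> measurable B ->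
    measurable (Z @^-1` B).
  by move=> mZ mB; rewrite -[_ @^-1` _]setTI; exact: mZ.
split=> [h l|h B mB].
- have [||_ _] := @agree_indic_nonneg _ _ _ P _ _ _ _ X0 Y0 b1 b1 (pois l) 1
    (measurable_pois l).
  + by move=> x x0; rewrite pois_ge0// pois_le1.
  + move=> B mB; split; [by apply: bounded_mfun_indic; exact: mpre..|].
    under eq_Rintegral do rewrite mulr1.
    under [RHS]eq_Rintegral do rewrite mulr1.
    have := h B mB; rewrite !prob_mean_indic; [by case|exact: mpre..].
  + under eq_Rintegral do rewrite mulr1.
    by under [RHS]eq_Rintegral do rewrite mulr1.
- have [|_ _] := @agree_pois_indic _ _ _ P _ _ _ _ X0 Y0 b1 b1 _ B mB.
    move=> l; split; [exact: bounded_mfun_pois..|].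
    under eq_Rintegral do rewrite mulr1.
    by under [RHS]eq_Rintegral do rewrite mulr1.
  under eq_Rintegral do rewrite mulr1.
  under [RHS]eq_Rintegral do rewrite mulr1.
  by rewrite !prob_mean_indic; [move=> e; congr (_%:E)|exact: mpre..].
Qed.

Lemma eq_law_discrete (V : countType) (Y Y' : T -> V) :
  (forall y, measurable (Y @^-1` [set y])) ->
  (forall y, measurable (Y' @^-1` [set y])) ->
  (forall y, P (Y @^-1` [set y]) = P (Y' @^-1` [set y])) ->
  forall S : set V, P (Y @^-1` S) = P (Y' @^-1` S).
Proof.
move=> mY mY' h S; have b1 := bounded_mfun_cst (T := T) (1 : R).
have [|_ _] := @agree_discrete _ _ _ P _ Y Y' _ _ b1 b1 _ S.
  move=> y; split.
  - exact: bounded_mfun_indic (mY y).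
  - exact: bounded_mfun_indic (mY' y).
  under eq_Rintegral do rewrite mulr1.
  under [RHS]eq_Rintegral do rewrite mulr1.
  by have := h y; rewrite !prob_mean_indic//; case.
under eq_Rintegral do rewrite mulr1.
under [RHS]eq_Rintegral do rewrite mulr1.
rewrite !prob_mean_indic; first by move=> e; congr (_%:E).
- exact: measurable_preimage_discrete.
- exact: measurable_preimage_discrete.
Qed.

(** Serves the arrival events, whose descriptions by counts rely on [N 0 = 0], an almost sure
    property. *)
Lemma eq_prob_ae (A B : set T) : measurable A -> measurable B ->
  {ae P, forall w, A w <-> B w} -> P A = P B.
Proof.
move=> mA mB AB; rewrite !prob_mean_indic//; congr (_%:E).
rewrite /Rintegral; congr fine.
apply: ae_eq_integral => //; [by apply/measurable_EFinP; exact: measurable_indic..|].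
apply: filterS AB => w [Aw Bw] _; congr (_%:E); rewrite !indicE.
by congr ((nat_of_bool _)%:R); apply/idP/idP => /set_mem ?; apply/mem_set; auto.
Qed.

End equality_in_law.

(** * Increments of the directing process and counts *)

Section increments.
Context {d : measure_display} {T : measurableType d} {R : realType}
  {P : probability T R}.
Variables (eta : R -> {RV P >-> R}) (N : R -> {RV P >-> nat}).
Hypothesis eta_nd : forall w : T, nondecreasing_path (fun t => eta t w).
Hypothesis N_cox : cox_process eta N.

Lemma ord_family_bigcap (n : nat) (A : nat -> set T) (B : 'I_n -> set T) :
  (forall i : 'I_n, A i = B i) -> [set w | forall i, B i w] = \bigcap_(i < n) A i.
Proof.
move=> AB; apply/seteqP; split=> [w h i ni|w h i].
  by have := h (Ordinal ni); rewrite -AB.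
by rewrite -AB; exact: h (ltn_ord i).
Qed.

Lemma independent_increments_counts : independent_increments eta ->
  forall (n : nat) (s : nat -> R) (l : nat -> nat), 0 <= s 0%N ->
    (forall i, (i < n)%N -> s i < s i.+1) ->
    P (\bigcap_(i < n) (incrN N (s i) (s i.+1) @^-1` [set l i])) =
    (\prod_(i < n) P (incrN N (s i) (s i.+1) @^-1` [set l i]))%E.
Proof.
move=> ind n s l s0 hs.
have hs' i : (i < n)%N -> s i <= s i.+1 by move=> /hs /ltW.
move: l; apply/(counts_independent_incr _ _ eta_nd N_cox n s s0 hs') => B mB.
have := ind n s s0 hs (fun i => B i) (fun i => mB i (ltn_ord i)).
by rewrite (ord_family_bigcap n (fun i => incr eta (s i) (s i.+1) @^-1` B i)).
Qed.

Lemma counts_independent_increments :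
  (forall (n : nat) (s : nat -> R) (l : nat -> nat), (0 < n)%N -> s 0%N = 0 ->
    (forall i, (i < n)%N -> s i < s i.+1) ->
    P (\bigcap_(i < n) (incrN N (s i) (s i.+1) @^-1` [set l i])) =
    (\prod_(i < n) P (incrN N (s i) (s i.+1) @^-1` [set l i]))%E) ->
  independent_increments eta.
Proof.
move=> counts.
have ind0 n s : (0 < n)%N -> s 0%N = 0 -> (forall i, (i < n)%N -> s i < s i.+1) ->
    forall B : nat -> set R, (forall i, (i < n)%N -> measurable (B i)) ->
    P (\bigcap_(i < n) (incr eta (s i) (s i.+1) @^-1` B i)) =
    (\prod_(i < n) P (incr eta (s i) (s i.+1) @^-1` B i))%E.
  move=> n0 s0 hs; apply/(counts_independent_incr _ _ eta_nd N_cox n s) => //.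
  - by rewrite s0.
  - by move=> i /hs /ltW.
  - by move=> l; exact: counts.
move=> n s s0 hs B mB.
have [n0|n0] := posnP n.
  subst n; rewrite big_ord0 (_ : [set w | _] = setT) ?probability_setT//.
  by apply/seteqP; split=> // w _ [].
pose C i := if insub i is Some j then B j else setT.
have CE (i : 'I_n) : C i = B i by rewrite /C valK.
have mC i : (i < n)%N -> measurable (C i).
  by move=> ni; rewrite (CE (Ordinal ni)); exact: mB.
rewrite (ord_family_bigcap n (fun i => incr eta (s i) (s i.+1) @^-1` C i));
  last by move=> i; rewrite CE.
transitivity (\prod_(i < n) P (incr eta (s i) (s i.+1) @^-1` C i))%E; last first.
  by apply: eq_bigr => i _; rewrite CE.
move: s0; rewrite le_eqVlt => /predU1P[/esym s0|s0]; first exact: ind0.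
(* The hypothesis concerns times starting at 0, so 0 is put in front of a positive first time, with
   the certain event on the additional interval. *)
pose s' i := if i is i'.+1 then s i' else 0.
pose C' i := if i is i'.+1 then C i' else setT.
have := ind0 n.+1 s' erefl erefl _ C'.
rewrite big_ord_recl /= preimage_setT probability_setT mul1e => <-.
- congr (P _); apply/seteqP; split=> [w h [|i]//= ni|w h i ni]; first exact: h.
  exact: (h i.+1).
- by move=> [|i] //= ni; exact: hs.
- by move=> [|i] //= ni; exact: mC.
Qed.

Lemma stationary_increments_counts : stationary_increments eta <->
  (forall (s h : R) (l : nat), 0 <= s -> 0 <= h ->
    P (incrN N s (s + h) @^-1` [set l]) = P (incrN N 0 h @^-1` [set l])).
Proof.
have eqlaw s h : 0 <= s -> 0 <= h ->
    (forall B : set R, measurable B ->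
      P (incr eta s (s + h) @^-1` B) = P (incr eta 0 h @^-1` B)) <->
    (forall l, P (incrN N s (s + h) @^-1` [set l]) =
      P (incrN N 0 h @^-1` [set l])).
  move=> s0 h0; have sh : s <= s + h by rewrite lerDl.
  rewrite eq_law_pois; last 4 first.
  - exact: measurable_incr.
  - exact: measurable_incr.
  - by move=> w; exact: incr_ge0.
  - by move=> w; exact: incr_ge0.
  split=> hl l; have := hl l.
    by rewrite !(cox_count _ _ eta_nd N_cox)// => ->.
  by rewrite !(cox_count _ _ eta_nd N_cox)// => -[].
split=> [st s h l s0 h0|st s h s0 h0 B mB].
  by move: l; apply/eqlaw => // B mB; exact: st.
by move: B mB; apply/eqlaw => // l; exact: st.
Qed.

End increments.

(** * Arrival times *)

(** The index q = j M + i lists the pairs lexicographically, so that blocks of equal length become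
    one sequence of times. *)
Lemma big_ord_divmod {V : Type} {idx : V} (op : Monoid.law idx) (k M : nat)
    (F : nat -> nat -> V) :
  \big[op/idx]_(q < k * M) F (q %/ M)%N (q %% M)%N =
  \big[op/idx]_(j < k) \big[op/idx]_(i < M) F j i.
Proof.
elim: k => [|k IH]; first by rewrite !big_ord0.
rewrite mulSnr big_split_ord big_ord_recr /= -IH; congr (op _ _).
apply: eq_bigr => i _; have M0 : (0 < M)%N by exact: leq_ltn_trans (ltn_ord i).
by rewrite divnMDl// modnMDl divn_small// modn_small// addn0.
Qed.

Section blocks.
Context {d : measure_display} {T : measurableType d} {R : realType}
  {P : probability T R}.
Variable N : R -> {RV P >-> nat}.
Hypothesis N_pp : point_process N.
Hypothesis counts : forall (n : nat) (s : nat -> R) (l : nat -> nat),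
  0 <= s 0%N -> (forall i, (i < n)%N -> s i <= s i.+1) ->
  P (\bigcap_(i < n) (incrN N (s i) (s i.+1) @^-1` [set l i])) =
  (\prod_(i < n) P (incrN N (s i) (s i.+1) @^-1` [set l i]))%E.

(** Tuples of a fixed length form a countable type, to which [independent_discrete] applies. *)
Definition count_tuple (M : nat) (q : nat -> R) (w : T) : M.-tuple nat :=
  [tuple incrN N (q i) (q i.+1) w | i < M].

Lemma count_tuple_preimage (M : nat) (q : nat -> R) (y : M.-tuple nat) :
  count_tuple M q @^-1` [set y] =
  \bigcap_(i < M) (incrN N (q i) (q i.+1) @^-1` [set nth 0%N y i]).
Proof.
apply/seteqP; split=> [w /= <- i iM|w h].
  have := tnth_nth 0%N (count_tuple M q w) (Ordinal iM).
  by rewrite tnth_mktuple => /= <-.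
apply/eq_from_tnth => i; rewrite tnth_mktuple (tnth_nth 0%N).
exact: (h i (ltn_ord i)).
Qed.

Lemma measurable_count_tuple (M : nat) (q : nat -> R) (S : set (M.-tuple nat)) :
  measurable (count_tuple M q @^-1` S).
Proof.
apply: measurable_preimage_discrete => y; rewrite count_tuple_preimage.
by apply: bigcap_measurableType => i _; exact: measurable_incrN.
Qed.

Lemma count_tuple_prob (M : nat) (q : nat -> R) (y : M.-tuple nat) :
  0 <= q 0%N -> (forall i, (i < M)%N -> q i <= q i.+1) ->
  P (count_tuple M q @^-1` [set y]) =
  (\prod_(i < M) P (incrN N (q i) (q i.+1) @^-1` [set nth 0%N y i]))%E.
Proof. by move=> q0 hq; rewrite count_tuple_preimage counts. Qed.

(** The blocks are strung together into one sequence of k M intervals, and the product rule there is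
    regrouped by blocks. *)
Lemma count_tuple_independent (k M : nat) (p : nat -> nat -> R) : (0 < M)%N ->
  0 <= p 0%N 0%N ->
  (forall j i, (j < k)%N -> (i < M)%N -> p j i <= p j i.+1) ->
  (forall j, (j < k)%N -> p j M = p j.+1 0%N) ->
  forall S : nat -> set (M.-tuple nat),
    P (\bigcap_(j < k) (count_tuple M (p j) @^-1` S j)) =
    (\prod_(j < k) P (count_tuple M (p j) @^-1` S j))%E.
Proof.
move=> M0 p0 hp pM; apply: independent_discrete => [j y _|y].
  exact: measurable_count_tuple.
pose s q := p (q %/ M)%N (q %% M)%N.
have divk q : (q < k * M)%N -> (q %/ M < k)%N by rewrite ltn_divLR.
have sS q : (q < k * M)%N -> s q.+1 = p (q %/ M)%N (q %% M).+1.
  move=> qkM; rewrite /s {1 2}(divn_eq q M) -addnS divnMDl// modnMDl.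
  (* At the last index of block j the next time is [p j.+1 0], which is the right end [p j M] of
     that block. *)
  have := ltn_pmod q M0; rewrite leq_eqVlt => /predU1P[->|qM].
    by rewrite divnn M0 modnn addn1 -pM ?divk.
  by rewrite (divn_small qM) (modn_small qM) addn0.
have hs q : (q < k * M)%N -> s q <= s q.+1.
  by move=> qkM; rewrite sS//; apply: hp; [exact: divk|exact: ltn_pmod].
have s0 : 0 <= s 0%N by rewrite /s div0n mod0n.
have p_ge0 j : (j < k)%N -> 0 <= p j 0%N.
  move=> jk; have -> : p j 0%N = s (j * M)%N by rewrite /s mulnK// modnMl.
  apply: le_trans s0 _; apply: (leq_steps_homo (k * M)) => //.
  by rewrite leq_mul2r ltnW// orbT.
transitivity (P (\bigcap_(q < k * M) (incrN N (s q) (s q.+1) @^-1`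
    [set nth 0%N (y (q %/ M)%N) (q %% M)%N]))).
  congr (P _); apply/seteqP; split=> [w h q qkM|w h j jk].
    have := h _ (divk _ qkM); rewrite count_tuple_preimage.
    by move=> /(_ _ (ltn_pmod q M0)); rewrite /preimage /= -sS.
  rewrite count_tuple_preimage => i iM.
  have qkM : (j * M + i < k * M)%N.
    apply: (@leq_trans (j.+1 * M)); first by rewrite mulSnr ltn_add2l.
    by rewrite leq_mul2r jk orbT.
  have := h _ qkM; rewrite /preimage /= sS// /s.
  by rewrite divnMDl// modnMDl (divn_small iM) (modn_small iM) addn0.
rewrite counts//.
transitivity (\prod_(q < k * M) P (incrN N (p (q %/ M)%N (q %% M)%N)
    (p (q %/ M)%N (q %% M).+1) @^-1` [set nth 0%N (y (q %/ M)%N) (q %% M)%N]))%E.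
  by apply: eq_bigr => q _; rewrite sS.
rewrite (big_ord_divmod _ k M (fun j i => P (incrN N (p j i) (p j i.+1)
  @^-1` [set nth 0%N (y j) i]))).
apply: eq_bigr => j _; rewrite count_tuple_prob//; first exact: p_ge0.
by move=> i iM; exact: hp.
Qed.

(** By [counts] both laws are products over the gaps, and stationarity moves every gap to the
    origin, so that only its length matters. *)
Lemma count_tuple_shift (M : nat) (q q' : nat -> R) :
  (forall (s h : R) (l : nat), 0 <= s -> 0 <= h ->
    P (incrN N s (s + h) @^-1` [set l]) = P (incrN N 0 h @^-1` [set l])) ->
  0 <= q 0%N -> 0 <= q' 0%N -> (forall i, (i < M)%N -> q i <= q i.+1) ->
  (forall i, (i < M)%N -> q' i.+1 - q' i = q i.+1 - q i) ->
  forall S : set (M.-tuple nat),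
    P (count_tuple M q @^-1` S) = P (count_tuple M q' @^-1` S).
Proof.
move=> st q0 q'0 hq qq'.
have hq' i : (i < M)%N -> q' i <= q' i.+1.
  by move=> iM; rewrite -subr_ge0 qq'// subr_ge0 hq.
apply: eq_law_discrete => [y|y|y]; [exact: measurable_count_tuple..|].
rewrite !count_tuple_prob//; apply: eq_bigr => -[i iM] _ /=.
have qi (r : nat -> R) : 0 <= r 0%N -> (forall i, (i < M)%N -> r i <= r i.+1) ->
    P (incrN N (r i) (r i.+1) @^-1` [set nth 0%N y i]) =
    P (incrN N 0 (r i.+1 - r i) @^-1` [set nth 0%N y i]).
  move=> r0 hr; rewrite -(st (r i)) ?subr_ge0 ?hr ?subrKC//.
  by apply: le_trans r0 _; apply: (leq_steps_homo M) => //; exact: ltnW.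
by rewrite qi// [RHS]qi// qq'.
Qed.

Lemma sum_incrN (q : nat -> R) (m : nat) (w : T) : 0 <= q 0%N ->
  (forall i, (i < m)%N -> q i <= q i.+1) ->
  (\sum_(i < m) incrN N (q i) (q i.+1) w)%N = incrN N (q 0%N) (q m) w.
Proof.
move=> q0; elim: m => [_|m IH hq]; first by rewrite big_ord0 /incrN subnn.
have hom := leq_steps_homo m.+1 q hq.
rewrite big_ord_recr /= IH; last by move=> i im; apply: hq; exact: ltnW.
have := incrN_le _ N_pp w (q 0%N) (q m) q0 (hom _ _ (leq0n _) (leqnSn _)).
have qm0 : 0 <= q m by exact: le_trans q0 (hom _ _ (leq0n _) (leqnSn _)).
have := incrN_le _ N_pp w (q m) (q m.+1) qm0 (hq _ (ltnSn _)).
have := incrN_le _ N_pp w (q 0%N) (q m.+1) q0 (hom _ _ (leq0n _) (leqnn _)).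
lia.
Qed.

(** The arrival event read off the counts: entry m counts the points in ]q m, q m.+1], so the sum
    over m <= i reaches up to [q i.+1], the place of the finer point numbered i from 0, by which i +
    1 points must have occurred. *)
Definition tuple_block (M l : nat) : set (M.-tuple nat) :=
  [set y | (forall i, (i < l)%N -> (i < \sum_(m < M | (m <= i)%N) tnth y m)%N) /\
           (\sum_(m < M) tnth y m)%N = l].

Lemma count_tuple_block (M l : nat) (q : nat -> R) (w : T) : (l < M)%N ->
  0 <= q 0%N -> (forall i, (i < M)%N -> q i <= q i.+1) ->
  tuple_block M l (count_tuple M q w) <->
  (forall i, (i < l)%N -> (i < incrN N (q 0%N) (q i.+1) w)%N) /\
  incrN N (q 0%N) (q M) w = l.
Proof.
move=> lM q0 hq; rewrite /tuple_block /=.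
have sumE i : (i < l)%N -> (\sum_(m < M | (m <= i)%N) tnth (count_tuple M q w) m)%N
    = incrN N (q 0%N) (q i.+1) w.
  move=> il; have iM : (i < M)%N by exact: ltn_trans lM.
  under eq_bigr do rewrite tnth_mktuple.
  rewrite -(big_ord_widen M (fun m => incrN N (q m) (q m.+1) w) iM) sum_incrN//.
  by move=> m mi; apply: hq; exact: leq_trans iM.
have sumM : (\sum_(m < M) tnth (count_tuple M q w) m)%N = incrN N (q 0%N) (q M) w.
  by under eq_bigr do rewrite tnth_mktuple; exact: sum_incrN.
by rewrite sumM; split=> -[h ->]; split=> // i il; have := h i il; rewrite sumE.
Qed.

End blocks.

(** * Arrival events over a partition *)

Section arrivals.
Context {d : measure_display} {T : measurableType d} {R : realType}
  {P : probability T R}.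
Variable N : R -> {RV P >-> nat}.
Hypothesis N_pp : point_process N.
Variables (t : R) (k : nat) (tau : nat -> R) (l : nat -> nat)
  (u : nat -> nat -> R).
Hypotheses (tauP : partition_upto t k tau) (uP : finer_points k tau l u).

(* Every block is padded with its right endpoint to the same number of points,
   one more than the largest l j, so that it also ends at that endpoint. *)
Let M := (\max_(j < k) l j).+1.

Definition fine_point (j i : nat) : R :=
  if i is i'.+1 then if (i' < l j)%N then u j i' else tau j.+1 else tau j.

Lemma l_lt_M j : (j < k)%N -> (l j < M)%N.
Proof. by move=> jk; rewrite ltnS (leq_bigmax (Ordinal jk)). Qed.

Lemma tau_ge0 j : (j <= k)%N -> 0 <= tau j.
Proof.
have [_ _ tau0 htau _] := tauP; move=> jk; rewrite -tau0.
by apply: (leq_steps_homo k) => // i ik; exact/ltW/htau.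
Qed.

Lemma fine_point_le j i : (j < k)%N -> fine_point j i <= fine_point j i.+1.
Proof.
move=> jk; have [_ _ _ /(_ j jk) htau _] := tauP; have [u1 u2] := uP j jk.
case: i => [|i] /=.
  by case: ifP => [l0|_]; [have /andP[/ltW] := u1 _ l0|exact: ltW].
case: (ltnP i.+1 (l j)) => il; first by rewrite (ltnW il); exact: u2.
by case: ifP => // il'; have /andP[] := u1 _ il'.
Qed.

Lemma fine_pointM j : (j < k)%N -> fine_point j M = tau j.+1.
Proof. by move=> jk; rewrite /fine_point /M ltnNge -ltnS l_lt_M. Qed.

Lemma fine_pointu j i : (i < l j)%N -> fine_point j i.+1 = u j i.
Proof. by rewrite /fine_point => ->. Qed.

(** The shift serves twice: c = 0 for the interval itself and c = [tau j] for its translate to the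
    origin. *)
Lemma fine_point_block j (c : R) (w : T) : (j < k)%N -> c <= tau j ->
  tuple_block M (l j) (count_tuple N M (fun i => fine_point j i - c) w) <->
  (forall i, (i < l j)%N -> (i < incrN N (tau j - c) (u j i - c) w)%N) /\
  incrN N (tau j - c) (tau j.+1 - c) w = l j.
Proof.
move=> jk cj; rewrite count_tuple_block//; first last.
- by move=> i _; rewrite lerD2r fine_point_le.
- by rewrite subr_ge0.
- exact: l_lt_M.
rewrite fine_pointM//; split=> -[h e]; split=> // i il; have := h i il;
  by rewrite fine_pointu.
Qed.

Lemma arrival_le_relative j i w : (j < k)%N -> (i < l j)%N ->
  (arrival N (N (tau j) w + i).+1 w <= (u j i)%:E)%E <->
  (i < incrN N (tau j) (u j i) w)%N.
Proof.
move=> jk il; have [/(_ i il)/andP[tu _] _] := uP j jk.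
rewrite arrival_le//; first by rewrite /incrN ltn_subRL.
by apply: le_trans (ltW tu); apply: tau_ge0; exact: ltnW.
Qed.

Lemma relative_block j : (j < k)%N ->
  [set w | (forall i, (i < l j)%N ->
              (arrival N (N (tau j) w + i).+1 w <= (u j i)%:E)%E)
           /\ incrN N (tau j) (tau j.+1) w = l j] =
  count_tuple N M (fine_point j) @^-1` tuple_block M (l j).
Proof.
move=> jk; have sub0 : (fun i => fine_point j i - 0) = fine_point j.
  by apply/funext => i; rewrite subr0.
apply/seteqP; split=> w; have := fine_point_block j 0 w jk (tau_ge0 _ (ltnW jk));
  rewrite sub0 !subr0 => blockP.
  move=> [h e]; apply/blockP; split=> // i il; rewrite subr0.
  by apply/arrival_le_relative => //; exact: h.
move=> /blockP[h e]; split=> // i il; apply/arrival_le_relative => //.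
by have := h i il; rewrite subr0.
Qed.

(** Fixing the counts of all earlier intervals turns the random number of preceding points into the
    constant offset of the joint event. *)
Let initial (j : nat) (w : T) : (j <= k)%N -> N 0 w = 0%N ->
  (forall m, (m < j)%N -> incrN N (tau m) (tau m.+1) w = l m) ->
  N (tau j) w = (\sum_(m < j) l m)%N.
Proof.
move=> + N0; elim: j => [_ _|j IH jk h].
  by have [_ _ -> _ _] := tauP; rewrite big_ord0.
have [_ _ _ /(_ j jk)/ltW htau _] := tauP.
rewrite -(incrN_le _ N_pp w _ _ (tau_ge0 _ (ltnW jk)) htau) h// big_ord_recr /=.
by rewrite IH ?(ltnW jk)// 1?addnC// => m mj; apply: h; exact: ltnW.
Qed.

Let arrival_set (c i : nat) (x : R) : 0 <= x ->
  [set w | (arrival N (c + i).+1 w <= x%:E)%E] = N x @^-1` [set m | (c + i < m)%N].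
Proof.
by move=> x0; apply/seteqP; split=> w /= /(arrival_le _ N_pp _ _ _ x0).
Qed.

Let measurable_arrivals (c h : nat) (x : nat -> R) (a b : R) :
  (forall i, (i < h)%N -> 0 <= x i) ->
  measurable [set w | (forall i, (i < h)%N ->
                         (arrival N (c + i).+1 w <= (x i)%:E)%E)
                      /\ incrN N a b w = h].
Proof.
move=> x0; apply: (@measurableI _ T (\bigcap_(i < h)
  [set w | (arrival N (c + i).+1 w <= (x i)%:E)%E]) (incrN N a b @^-1` [set h])).
  apply: bigcap_measurableType => i /= ih; rewrite arrival_set; last exact: x0.
  by rewrite -[_ @^-1` _]setTI; exact: measurable_funPT.
exact: measurable_incrN.
Qed.

Let u_ge0 j i : (j < k)%N -> (i < l j)%N -> tau j <= u j i.
Proof. by move=> jk il; have [/(_ i il)/andP[/ltW]] := uP j jk. Qed.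

(** Both events fix all counts, so by [initial] the constant offsets agree with the random ones
    [N (tau j) w] off a null set; with random offsets, [relative_block] makes each member of the
    intersection depend on its own block alone. *)
Lemma joint_block :
  P (\bigcap_(j < k)
       [set w | (forall i, (i < l j)%N ->
                   (arrival N (\sum_(m < j) l m + i).+1 w <= (u j i)%:E)%E)
                /\ incrN N (tau j) (tau j.+1) w = l j]) =
  P (\bigcap_(j < k) (count_tuple N M (fine_point j) @^-1` tuple_block M (l j))).
Proof.
have [N0 _ _] := N_pp.
apply: eq_prob_ae.
- apply: bigcap_measurableType => j jk; apply: measurable_arrivals => // i il.
  by apply: le_trans (u_ge0 j i jk il); apply: tau_ge0; exact: ltnW.
- by apply: bigcap_measurableType => j jk; exact: measurable_count_tuple.
apply: filterS N0 => w N0; split=> h j jk.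
  rewrite -relative_block//; have [h1 h2] := h j jk; split=> // i il.
  rewrite (initial j)//; [exact: h1|exact: ltnW|].
  by move=> m mj; have [] := h m (ltn_trans mj jk).
have hr m : (m < k)%N -> [set w | (forall i, (i < l m)%N ->
      (arrival N (N (tau m) w + i).+1 w <= (u m i)%:E)%E)
      /\ incrN N (tau m) (tau m.+1) w = l m] w.
  by move=> mk; rewrite relative_block//; exact: h.
have [h1 h2] := hr j jk; split=> // i il.
rewrite -(initial j w)//; [exact: h1|exact: ltnW|].
by move=> m mj; have [] := hr m (ltn_trans mj jk).
Qed.

Lemma shifted_block j : (j < k)%N ->
  P [set w | (forall i, (i < l j)%N ->
                (arrival N i.+1 w <= (u j i - tau j)%:E)%E)
             /\ incrN N 0 (tau j.+1 - tau j) w = l j] =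
  P (count_tuple N M (fun i => fine_point j i - tau j) @^-1` tuple_block M (l j)).
Proof.
move=> jk; have [N0 _ _] := N_pp; have ut0 i : (i < l j)%N -> 0 <= u j i - tau j.
  by move=> il; rewrite subr_ge0 u_ge0.
apply: eq_prob_ae; [exact: (measurable_arrivals 0)|exact: measurable_count_tuple|].
apply: filterS N0 => w N0; have := fine_point_block j (tau j) w jk (lexx _).
rewrite subrr => blockP; rewrite /preimage /=.
have aE i : (i < l j)%N -> (arrival N i.+1 w <= (u j i - tau j)%:E)%E <->
    (i < incrN N 0 (u j i - tau j) w)%N.
  by move=> il; rewrite arrival_le ?ut0// /incrN N0 subn0.
split=> [[h e]|/blockP[h e]].
  by apply/blockP; split=> // i il; apply/aE => //; exact: h.
by split=> // i il; apply/aE => //; exact: h.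
Qed.

Hypothesis counts : forall (n : nat) (s : nat -> R) (l : nat -> nat),
  0 <= s 0%N -> (forall i, (i < n)%N -> s i <= s i.+1) ->
  P (\bigcap_(i < n) (incrN N (s i) (s i.+1) @^-1` [set l i])) =
  (\prod_(i < n) P (incrN N (s i) (s i.+1) @^-1` [set l i]))%E.

Lemma arrivals_independent :
  P (\bigcap_(j < k)
       [set w | (forall i, (i < l j)%N ->
                   (arrival N (\sum_(m < j) l m + i).+1 w <= (u j i)%:E)%E)
                /\ incrN N (tau j) (tau j.+1) w = l j]) =
  (\prod_(j < k) P
       [set w | (forall i, (i < l j)%N ->
                   (arrival N (N (tau j) w + i).+1 w <= (u j i)%:E)%E)
                /\ incrN N (tau j) (tau j.+1) w = l j])%E.
Proof.
rewrite joint_block (count_tuple_independent _ counts).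
- by apply: eq_bigr => j _; rewrite relative_block.
- by [].
- exact: tau_ge0.
- by move=> j i jk _; exact: fine_point_le.
- by move=> j jk; rewrite fine_pointM.
Qed.

Lemma arrivals_stationary j : (j < k)%N ->
  (forall (s h : R) (l : nat), 0 <= s -> 0 <= h ->
    P (incrN N s (s + h) @^-1` [set l]) = P (incrN N 0 h @^-1` [set l])) ->
  P [set w | (forall i, (i < l j)%N ->
                (arrival N (N (tau j) w + i).+1 w <= (u j i)%:E)%E)
             /\ incrN N (tau j) (tau j.+1) w = l j] =
  P [set w | (forall i, (i < l j)%N ->
                (arrival N i.+1 w <= (u j i - tau j)%:E)%E)
             /\ incrN N 0 (tau j.+1 - tau j) w = l j].
Proof.
move=> jk st; rewrite relative_block// shifted_block//.
apply: (count_tuple_shift _ counts) => //.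
- by apply: tau_ge0; exact: ltnW.
- by rewrite /= subrr.
- by move=> i _; exact: fine_point_le.
- by move=> i _; ring.
Qed.

End arrivals.

(** * Product rules over partitions and the type of process *)

Section equivalences.
Context {d : measure_display} {T : measurableType d} {R : realType}
  {P : probability T R}.
Variables (eta : R -> {RV P >-> R}) (N : R -> {RV P >-> nat}).
Hypothesis eta_nd : forall w : T, nondecreasing_path (fun t => eta t w).
Hypothesis N_cox : cox_process eta N.

Lemma partition_upto_last (n : nat) (s : nat -> R) : (0 < n)%N -> s 0%N = 0 ->
  (forall i, (i < n)%N -> s i < s i.+1) -> partition_upto (s n) n s.
Proof.
move=> n0 s0 hs; split=> //; case: n n0 hs => // n _ hs.
rewrite -s0; apply: lt_le_trans (hs 0%N _) _ => //.
by apply: (leq_steps_homo n.+1) => // i /hs /ltW.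
Qed.

(* Summing over the count of the first interval ]0, s] leaves the count of
   ]s, s + h] alone. *)
Lemma stationary_of_partitions :
  (forall (t : R) (k : nat) (tau : nat -> R) (l : nat -> nat),
     partition_upto t k tau ->
     P (\bigcap_(j < k) [set w | incrN N (tau j) (tau j.+1) w = l j]) =
     (\prod_(j < k) P [set w | incrN N 0 (tau j.+1 - tau j) w = l j])%E) ->
  forall (s h : R) (b : nat), 0 <= s -> 0 <= h ->
    P (incrN N s (s + h) @^-1` [set b]) = P (incrN N 0 h @^-1` [set b]).
Proof.
(* Partitions increase strictly, so s = 0 and h = 0 are settled separately. *)
move=> H s h b; rewrite le_eqVlt => /predU1P[<- _|s0]; first by rewrite add0r.
rewrite le_eqVlt => /predU1P[<-|h0].
  rewrite addr0; congr (P _).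
  by apply/seteqP; split=> w; rewrite /preimage /= /incrN !subnn.
pose tau i := if i is i'.+1 then if i' is 0%N then s else s + h else 0.
have part : partition_upto (tau 2%N) 2 tau.
  by apply: partition_upto_last => // -[|[|i]]//= _; rewrite ltrDl.
have mN x y (S : set nat) : measurable (incrN N x y @^-1` S).
  exact: measurable_incrN.
have ab a : P (incrN N 0 s @^-1` [set a] `&` incrN N s (s + h) @^-1` [set b]) =
    (P (incrN N 0 s @^-1` [set a]) * P (incrN N 0 h @^-1` [set b]))%E.
  have := H _ _ _ (fun i => if i is 0%N then a else b) part.
  rewrite !big_ord_recl big_ord0 mule1 /= subr0 addrAC subrr add0r => <-.
  congr (P _); apply/seteqP; split=> [w [w1 w2] [|[|i]]//|w hw].
  by split; [exact: (hw 0%N)|exact: (hw 1%N)].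
have bG : bounded_mfun (\1_(incrN N s (s + h) @^-1` [set b]) : T -> R).
  exact: bounded_mfun_indic.
have bH := bounded_mfun_cst (T := T) (fine (P (incrN N 0 h @^-1` [set b]))).
(* The densities are the indicator of count b on ]s, s + h] and the constant probability of count b
   on ]0, h]. Agreement at each value a of the first count extends to [setT], where the test
   function is 1. *)
have [|_ _] := @agree_discrete _ _ _ P _ (incrN N 0 s) (incrN N 0 s) _ _
  bG bH _ setT.
  move=> a; split; [exact: (bounded_mfun_indic (incrN N 0 s @^-1` [set a]))..|].
  transitivity (\int[P]_w (\1_(incrN N 0 s @^-1` [set a] `&`
      incrN N s (s + h) @^-1` [set b]) w)).
    by apply: eq_Rintegral => w _; rewrite indicI.
  under [RHS]eq_Rintegral do rewrite mulrC.
  rewrite meanZ; last exact: (bounded_mfun_indic (incrN N 0 s @^-1` [set a])).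
  rewrite mean_indic; last exact: measurableI.
  rewrite ab fineM ?fin_num_measure// mulrC; congr (_ * _).
  by rewrite -(mean_indic (incrN N 0 s @^-1` [set a])).
under eq_Rintegral do rewrite indicT mul1r.
under [RHS]eq_Rintegral do rewrite indicT mul1r.
rewrite mean_cst mean_indic// => e.
by rewrite -[LHS]fineK ?fin_num_measure// e fineK ?fin_num_measure.
Qed.

Lemma additive_of_partitions :
  {ae P, forall w, eta 0 w = 0} -> (forall w : T, cadlag (fun t => eta t w)) ->
  stochastically_continuous eta ->
  (forall (t : R) (k : nat) (tau : nat -> R) (l : nat -> nat),
     partition_upto t k tau ->
     P (\bigcap_(j < k) [set w | incrN N (tau j) (tau j.+1) w = l j]) =
     (\prod_(j < k) P [set w | incrN N (tau j) (tau j.+1) w = l j])%E) ->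
  additive_process eta.
Proof.
move=> eta0 eta_cadlag eta_sc H; split=> //.
apply: (counts_independent_increments _ _ eta_nd N_cox) => n s l n0 s0 hs.
exact: (H (s n) n s l (partition_upto_last n s n0 s0 hs)).
Qed.

Lemma partitions_of_additive : additive_process eta ->
  forall (t : R) (k : nat) (tau : nat -> R) (l : nat -> nat),
     partition_upto t k tau ->
     P (\bigcap_(j < k) [set w | incrN N (tau j) (tau j.+1) w = l j]) =
     (\prod_(j < k) P [set w | incrN N (tau j) (tau j.+1) w = l j])%E.
Proof.
move=> [_ _ _ ind] t k tau l [_ _ tau0 htau _].
by apply: (independent_increments_counts _ _ eta_nd N_cox) => //; rewrite tau0.
Qed.

End equivalences.

Local Open Scope ereal_scope.

Theorem theorem2p1 (d : measure_display) (T : measurableType d) (R : realType)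
    (P : probability T R) (eta : R -> {RV P >-> R}) (N : R -> {RV P >-> nat})
    (eta_nondecreasing : forall w : T, nondecreasing_path (fun t => eta t w))
    (eta_cadlag : forall w : T, cadlag (fun t => eta t w))
    (eta_at0 : {ae P, forall w, eta 0%R w = 0%R})
    (eta_stoch_cont : stochastically_continuous eta)
    (N_cox : cox_process eta N) :
  (* (i) *)
  (((forall (t : R) (k : nat) (tau : nat -> R) (l : nat -> nat),
       partition_upto t k tau ->
       P (\bigcap_(j < k) [set w | incrN N (tau j) (tau j.+1) w = l j]) =
       \prod_(j < k) P [set w | incrN N (tau j) (tau j.+1) w = l j])
    <-> additive_process eta)
   /\
   (additive_process eta ->
    forall (t : R) (k : nat) (tau : nat -> R) (l : nat -> nat)
           (u : nat -> nat -> R),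
      partition_upto t k tau -> finer_points k tau l u ->
      P (\bigcap_(j < k)
           [set w | (forall i : nat, (i < l j)%N ->
                       arrival N (\sum_(m < j) l m + i).+1 w <= (u j i)%:E)
                    /\ incrN N (tau j) (tau j.+1) w = l j]) =
      (* within a single factor the points of the j-th interval are preceded
         by the random number N (tau j) of points, not by \sum_(m < j) l m *)
      \prod_(j < k) P
           [set w | (forall i : nat, (i < l j)%N ->
                       arrival N (N (tau j) w + i).+1 w <= (u j i)%:E)
                    /\ incrN N (tau j) (tau j.+1) w = l j]))
  /\
  (* (ii) *)
  (((forall (t : R) (k : nat) (tau : nat -> R) (l : nat -> nat),
       partition_upto t k tau ->
       P (\bigcap_(j < k) [set w | incrN N (tau j) (tau j.+1) w = l j]) =
       \prod_(j < k) P [set w | incrN N 0%R (tau j.+1 - tau j)%R w = l j])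
    <-> subordinator eta)
   /\
   (subordinator eta ->
    forall (t : R) (k : nat) (tau : nat -> R) (l : nat -> nat)
           (u : nat -> nat -> R),
      partition_upto t k tau -> finer_points k tau l u ->
      P (\bigcap_(j < k)
           [set w | (forall i : nat, (i < l j)%N ->
                       arrival N (\sum_(m < j) l m + i).+1 w <= (u j i)%:E)
                    /\ incrN N (tau j) (tau j.+1) w = l j]) =
      \prod_(j < k) P
           [set w | (forall i : nat, (i < l j)%N ->
                       arrival N i.+1 w <= (u j i - tau j)%:E)
                    /\ incrN N 0%R (tau j.+1 - tau j)%R w = l j])).
Proof.
have [N_pp _] := N_cox.
(* Finer points may coincide, so the arrival statements need the product rule for weakly increasing
   times. *)
have weak (add : additive_process eta) :=
  let: And4 _ _ _ ind := add in
  counts_independent_weak eta N N_cox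
    (independent_increments_counts eta N eta_nondecreasing N_cox ind).
have stat (sub : subordinator eta) : forall (s h : R) (l : nat),
    (0 <= s)%R -> (0 <= h)%R ->
    P (incrN N s (s + h)%R @^-1` [set l]) = P (incrN N 0%R h @^-1` [set l]).
  have [[_ st] _] := sub.
  by apply/(stationary_increments_counts eta N eta_nondecreasing N_cox).
have shift t k tau l j : partition_upto t k tau -> (j < k)%N ->
    (forall (s h : R) (l : nat), (0 <= s)%R -> (0 <= h)%R ->
      P (incrN N s (s + h)%R @^-1` [set l]) = P (incrN N 0%R h @^-1` [set l])) ->
    P [set w | incrN N (tau j) (tau j.+1) w = l j] =
    P [set w | incrN N 0%R (tau j.+1 - tau j)%R w = l j].
  move=> part jk st; have [_ _ _ htau _] := part.
  have := st (tau j) (tau j.+1 - tau j)%R (l j) (tau_ge0 _ _ _ part j (ltnW jk)).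
  by rewrite subrKC subr_ge0; apply; exact/ltW/htau.
split; split.
- split; last exact: partitions_of_additive.
  exact: (additive_of_partitions eta N eta_nondecreasing N_cox).
- move=> add t k tau l u part finer.
  exact: (arrivals_independent N N_pp t k tau l u part finer (weak add)).
- split=> [H|sub t k tau l part].
    (* Stationarity comes first: it replaces the counts on ]0, h] in the hypothesis by those on the
       actual intervals, which is the product rule required for additivity. *)
    have st := stationary_of_partitions N H.
    split=> //; split.
      apply: (additive_of_partitions eta N eta_nondecreasing N_cox) => //.
      move=> t k tau l part.
      rewrite (H t)//; apply: eq_bigr => j _.
      by rewrite (shift t k tau l j part (ltn_ord j) st).
    exact/(stationary_increments_counts eta N eta_nondecreasing N_cox).
  have [[add _] _] := sub.
  rewrite (partitions_of_additive eta N eta_nondecreasing N_cox add t)//.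
  apply: eq_bigr => j _.
  by rewrite (shift t k tau l j part (ltn_ord j) (stat sub)).
- move=> sub t k tau l u part finer; have [[add _] _] := sub.
  rewrite (arrivals_independent N N_pp t k tau l u part finer (weak add)).
  apply: eq_bigr => j _.
  exact: (arrivals_stationary N N_pp t k tau l u part finer (weak add)
    j (ltn_ord j) (stat sub)).
Qed.
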